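(* In the quadratic-loss setting described in the context, the worst-case additive suboptimality of the shrinkage path heuristic satisfies $$\sup_{\rho\ge0}\big(\hat f_\rho-f^\star_\rho\big)\;\le\;\lambda_{\max}\,\|\boldsymbol x(0)\|_2^2\,\frac{(\kappa-1)^2}{\kappa\,[\varphi^5(\kappa-1)+27]},$$ where $\varphi=(\sqrt5+1)/2$. The bound is asymptotically tight as $\kappa\to1^+$ and as $\kappa\to\infty$: in each of the two regimes there is a sequence of instances of this setting with $\boldsymbol x(0)\ne\boldsymbol0$, whose condition numbers $\kappa>1$ tend to $1$ (respectively to $\infty$), along which the ratio of the left-hand side to the right-hand side tends to $1$.
   Context: Setting. The decision $\boldsymbol x$ and the uncertain vector $\boldsymbol\xi$ have the same dimension $k=n$; the support is $\Xi=\mathbb R^n$ and the feasible set is $\mathcal X(\Xi)=\mathbb R^n$. The empirical distribution is $\hat{\mathbb P}=\frac1N\sum_{i=1}^N\delta_{\hat{\boldsymbol\xi}_i}$, $\hat{\boldsymbol\xi}_i\in\mathbb R^n$. The loss is $\ell(\boldsymbol x,\boldsymbol\xi)=L(\boldsymbol\xi^\top\boldsymbol x)$ with $L:\mathbb R\to\mathbb R_+$ convex, Lipschitz and differentiable. $\mathbb B_\rho(\hat{\mathbb P})$ is the set of probability measures on $\mathbb R^n$ whose type-1 Wasserstein distance (with ground metric $\|\boldsymbol\xi-\boldsymbol\xi'\|_2$) to $\hat{\mathbb P}$ is at most $\rho$. Values. $f_\rho(\boldsymbol x)=\sup_{\mathbb Q\in\mathbb B_\rho(\hat{\mathbb P})}\mathbb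 E_{\mathbb Q}[\ell(\boldsymbol x,\tilde{\boldsymbol\xi})]$; $f^\star_\rho=\min_{\boldsymbol x\in\mathbb R^n}f_\rho(\boldsymbol x)$. $\boldsymbol x(0)$ is a fixed minimizer of $f_0(\boldsymbol x)=\frac1N\sum_iL(\hat{\boldsymbol\xi}_i^\top\boldsymbol x)$ over $\mathbb R^n$ (assumed to exist), and $\boldsymbol x(\infty)$ is the robust solution, i.e. a minimizer of $\sup_{\boldsymbol\xi\in\mathbb R^n}L(\boldsymbol\xi^\top\boldsymbol x)$, which in this setting is $\boldsymbol x(\infty)=\boldsymbol0$. The value of the shrinkage path heuristic is $\hat f_\rho=\min_{\lambda\in[0,1]}f_\rho((1-\lambda)\boldsymbol x(0)+\lambda\boldsymbol x(\infty))$. Quadratic loss assumptions. With $\mathcal Z:=\{\boldsymbol x^\top\hat{\boldsymbol\xi}_i:\|\boldsymbol x\|_2\le\|\boldsymbol x(0)\|_2,\ i\in[N]\}$, there are $b,c\in\mathbb R$ with $L(z)=z^2+bz+c$ for all $z\in\mathcal Z$. The matrix $\boldsymbol H:=\frac1N\sum_{i=1}^N\hat{\boldsymbol\xi}_i\hat{\boldsymbol\xi}_i^\top$ is positive definite with eigenvalues $0<\lambda_{\min}\le\cdots\le\lambda_{\max}$ and condition number $\kappa:=\lambda_{\max}/\lambda_{\min}$. *)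

(* Defs.v *)
From HB Require Import structures.
From mathcomp Require Import all_boot all_order all_algebra.
From mathcomp Require Import all_classical all_reals all_analysis.

Set Implicit Arguments.
Unset Strict Implicit.
Unset Printing Implicit Defensive.

Import Order.TTheory GRing.Theory Num.Theory.
Import numFieldNormedType.Exports.

Local Open Scope classical_set_scope.
Local Open Scope ring_scope.

Definition minimizer (T : Type) (d : Order.disp_t) (V : porderType d)
  (f : T -> V) (x : T) : Prop := forall y, (f x <= f y)%O.

Section Euclidean.
Variables (R : realType) (n : nat).

(* The library's norm on matrices is the sup norm, hence this definition; both
   norms induce the same topology. *)
Definition norm2 (x : 'cV[R]_n) : R := Num.sqrt (\sum_i x i 0 ^+ 2).

Definition inner (u v : 'cV[R]_n) : R := (u^T *m v) 0 0.

Definition borel_cV := g_sigma_algebraType (@open 'cV[R]_n).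

Definition posdef (A : 'M[R]_n) : Prop :=
  A^T = A /\ forall v : 'cV[R]_n, v != 0 -> 0 < inner v (A *m v).

Definition min_eigenvalue (A : 'M[R]_n) (a : R) : Prop :=
  eigenvalue A a /\ forall b, eigenvalue A b -> a <= b.

Definition max_eigenvalue (A : 'M[R]_n) (a : R) : Prop :=
  eigenvalue A a /\ forall b, eigenvalue A b -> b <= a.

End Euclidean.

Section Wasserstein.
Variables (R : realType) (n : nat).
Local Notation E := (borel_cV R n).
Local Open Scope ereal_scope.

Definition coupling (P Q : {measure set E -> \bar R})
    (pi : probability (E * E)%type R) : Prop :=
  forall A : set E, measurable A ->
    pi (A `*` setT) = P A /\ pi (setT `*` A) = Q A.

Definition transport_cost (pi : probability (E * E)%type R) : \bar R :=
  \int[pi]_p (norm2 (p.1 - p.2 : 'cV[R]_n))%:E.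

(* Takes the value +oo when there is no coupling of finite cost. *)
Definition wasserstein1 (P Q : {measure set E -> \bar R}) : \bar R :=
  ereal_inf [set transport_cost pi | pi in coupling P Q].

End Wasserstein.

Section Empirical.
Variables (R : realType) (n N : nat) (xi : 'I_N -> 'cV[R]_n).
Local Notation E := (borel_cV R n).
Local Open Scope ereal_scope.

Definition empirical (A : set E) : \bar R :=
  (N%:R^-1)%:E * \sum_(i < N) \d_(xi i : E) A.

Let empirical0 : empirical set0 = 0.
Proof.
by rewrite /empirical big1 ?mule0// => i _; rewrite measure0.
Qed.

Let empirical_ge0 A : 0 <= empirical A.
Proof.
rewrite /empirical mule_ge0 ?lee_fin ?invr_ge0//.
by apply: sume_ge0 => i _; exact: measure_ge0.
Qed.

Let empirical_sigma_additive : semi_sigma_additive empirical.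
Proof.
move=> F mF tF mUF.
pose m (k : nat) : {measure set E -> \bar R} :=
  if insub k is Some i then \d_(xi i : E) else mzero.
have N_ge0 : (0 <= (N%:R : R)^-1)%R by rewrite invr_ge0.
pose r := NngNum N_ge0.
have -> : empirical = mscale r (msum m N).
  apply/funext => A; rewrite /empirical /mscale /msum/=; congr (_ * _).
  by apply: eq_bigr => i _; rewrite /m valK.
exact: measure_semi_sigma_additive.
Qed.

HB.instance Definition _ := isMeasure.Build _ E R empirical
  empirical0 empirical_ge0 empirical_sigma_additive.

End Empirical.

(* The dimension and the sample size are part of the data, so that both may vary
   along a sequence of instances. *)
Record instance (R : realType) := Instance {
  dim : nat ;
  nsamples : nat ;
  sample : 'I_nsamples -> 'cV[R]_dim ;
  lossfun : R -> R ;
  nominal_sol : 'cV[R]_dim ;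
  robust_sol : 'cV[R]_dim ;
  lmin : R ;
  lmax : R
}.

Section Setting.
Variables (R : realType) (I : instance R).
Local Notation n := (dim I).
Local Notation N := (nsamples I).
Local Notation xi := (@sample R I).
Local Notation L := (lossfun I).
Local Notation E := (borel_cV R n).

Definition loss (x : 'cV[R]_n) (z : 'cV[R]_n) : R := L (inner z x).

Definition wball (rho : R) : set (probability E R) :=
  [set Q | (wasserstein1 Q (empirical xi) <= rho%:E)%E].

Definition frho (rho : R) (x : 'cV[R]_n) : \bar R :=
  ereal_sup [set ('E_Q[loss x])%E | Q in wball rho].

Definition fstar (rho : R) : \bar R := ereal_inf (range (frho rho)).

Definition shrink_path (t : R) : 'cV[R]_n :=
  (1 - t) *: nominal_sol I + t *: robust_sol I.

Definition fhat (rho : R) : \bar R :=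
  ereal_inf [set frho rho (shrink_path t) | t in `[0, 1]].

(* Under [quadratic_setting], [loss x] is nonnegative and Lipschitz, so [frho] and
   its infima are finite and the difference is never of the form +oo - +oo. *)
Definition subopt : \bar R :=
  ereal_sup [set (fhat rho - fstar rho)%E | rho in [set rho | 0 <= rho]].

Definition emp_loss (x : 'cV[R]_n) : R := N%:R^-1 * \sum_i loss x (xi i).

Definition worst_loss (x : 'cV[R]_n) : \bar R :=
  ereal_sup (range (fun z => (loss x z)%:E)).

Definition second_moment : 'M[R]_n := N%:R^-1 *: \sum_i (xi i *m (xi i)^T).

Definition Zset : set R :=
  [set z | exists x i, norm2 x <= norm2 (nominal_sol I) /\ z = inner x (xi i)].

(* [robust_sol_min] forces [robust_sol I = 0] unless [L] is constant, in which case
   every point is optimal for every problem involved. *)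
Record quadratic_setting : Prop := QuadraticSetting {
  dim_gt0 : (0 < n)%N ;
  nsamples_gt0 : (0 < N)%N ;
  loss_ge0 : forall z, 0 <= L z ;
  loss_convex : convex_function (setT : set R^o) L ;
  loss_lipschitz : [lipschitz (L : R^o -> R^o) z | z in setT] ;
  loss_derivable : forall z, derivable (L : R^o -> R^o) z 1 ;
  nominal_sol_min : minimizer emp_loss (nominal_sol I) ;
  robust_sol_min : minimizer worst_loss (robust_sol I) ;
  loss_quadratic :
    exists b c : R, forall z, Zset z -> L z = z ^+ 2 + b * z + c ;
  second_moment_posdef : posdef second_moment ;
  lmin_eigen : min_eigenvalue second_moment (lmin I) ;
  lmax_eigen : max_eigenvalue second_moment (lmax I)
}.

Definition cond : R := lmax I / lmin I.

Definition golden : R := (Num.sqrt 5 + 1) / 2.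

Definition bound : R :=
  lmax I * norm2 (nominal_sol I) ^+ 2 *
  ((cond - 1) ^+ 2 / (cond * (golden ^+ 5 * (cond - 1) + 27))).

End Setting.

(* Main.v *)
(* If [M] is the largest slope of the loss, attained asymptotically by convexity,
   moving an arbitrarily small mass arbitrarily far shows that the worst case over
   the Wasserstein ball is the regularised value [emp_loss x + rho * M * |x|].
   On the ball of radius [|x0|], [x0] the nominal solution, the empirical loss is
   [emp_loss x0] plus a linear function of [x - x0], nonnegative there by
   optimality, plus [(x - x0)^T H (x - x0)]; by differentiability the linear part
   vanishes along the shrinkage path.  With [c = rho * M] and [eta = c / (2 |x|)],
   the identity [c |x| = eta |x|^2 + c^2 / (4 eta)] turns the comparison into ridge
   regression, where the suboptimality is at most [eta^2] times a Jensen gap of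
   [1 / (lambda + eta)] over the spectrum of [H].  That gap is at most
   [(1 / sqrt (lmin + eta) - 1 / sqrt (lmax + eta))^2], and a one-variable
   optimisation in [eta] produces the golden ratio.  Tightness is witnessed in the
   plane by two samples interpolated exactly by [x0], with a Huber loss, for which
   the inequalities above become equalities in the limit. *)
Require Import Defs.
From HB Require Import structures.
From mathcomp Require Import all_boot all_order all_algebra.
From mathcomp Require Import all_classical all_reals all_analysis.
From mathcomp Require Import measurable_realfun.
From mathcomp Require Import ring lra.

Set Implicit Arguments.
Unset Strict Implicit.
Unset Printing Implicit Defensive.

Import Order.TTheory GRing.Theory Num.Theory.
Import numFieldNormedType.Exports.

Local Open Scope classical_set_scope.
Local Open Scope ring_scope.

(** * Scalar inequalities *)

(** The difference of the two sides is [(r - p)^2 (r + p^3)], with a double root at the golden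
    ratio; this is where the constant [p^5] comes from. *)
Lemma golden_cubic (R : realFieldType) (p r : R) :
  p ^+ 2 = p + 1 -> 0 <= p -> 0 <= r ->
  p ^+ 5 * (r - 1) <= r ^+ 2 * (r + 1).
Proof.
move=> p2 p0 r0; rewrite -subr_ge0.
have p3 : p ^+ 3 = 2 * p + 1 by rewrite exprS p2 mulrDr -expr2 p2; ring.
have -> : r ^+ 2 * (r + 1) - p ^+ 5 * (r - 1) = (r - p) ^+ 2 * (r + p ^+ 3).
  have -> : p ^+ 5 = p ^+ 2 * p ^+ 3 by ring.
  rewrite p3.
  have -> : (r - p) ^+ 2 = r ^+ 2 - 2 * r * p + p ^+ 2 by ring.
  have pp : p * p = p + 1 by rewrite -expr2.
  rewrite p2; ring : pp.
by rewrite mulr_ge0 ?sqr_ge0// addr_ge0// exprn_ge0.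
Qed.

(** With [B = 1 + A / 27] and [v = 1 - u] this reads [27 v^2 (B - v) <= 4 B^3], the AM-GM inequality
    for [v/2], [v/2], [B - v], in factored form. *)
Lemma amgm_cubic (R : realFieldType) (A u : R) : 0 <= A -> u <= 1 ->
  (1 - u) ^+ 2 * (A + 27 * u) <= 4 * (1 + A / 27) ^+ 3.
Proof.
move=> A0 u1; rewrite -subr_ge0.
have -> : 4 * (1 + A / 27) ^+ 3 - (1 - u) ^+ 2 * (A + 27 * u) =
  (2 * (1 + A / 27) - 3 * (1 - u)) ^+ 2 * (1 + A / 27 + 3 * (1 - u)) by field.
by rewrite mulr_ge0 ?sqr_ge0//; lra.
Qed.

(* Equality holds at [r = 1, u = 1/3] and at [r = phi, u = 0], with phi the
   golden ratio: these are the two tight regimes. *)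
Lemma golden_kernel (R : realFieldType) (p r u : R) :
  p ^+ 2 = p + 1 -> 0 <= p -> 1 <= r -> 0 <= u <= 1 ->
  (1 - u) ^+ 2 * (p ^+ 5 * (r ^+ 2 - 1) + 27 * u) <= r ^+ 2 * (1 + r) ^+ 2.
Proof.
move=> p2 p0 r1 /andP[u0 u1].
have pE : p ^+ 5 = 5 * p + 3.
  have -> : p ^+ 5 = (p ^+ 2) ^+ 2 * p by ring.
  have pp : p * p = p + 1 by rewrite -expr2.
  by rewrite p2; ring : pp.
have plo : 8 / 5 <= p by nra.
have phi : p <= 13 / 8 by nra.
have C0 : 0 <= p ^+ 5 * (r ^+ 2 - 1).
  by rewrite mulr_ge0 ?exprn_ge0// subr_ge0 exprn_ege1.
(* Let [A = p^5 (r^2 - 1)]. Up to [r = 3/2], AM-GM bounds the left-hand side uniformly in [u];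
   beyond, [A >= 27/2] makes it nonincreasing in [u], and [u = 0] is [golden_cubic]. *)
have [r149|r149] := leP r (3 / 2).
  apply: le_trans (amgm_cubic C0 u1) _.
  pose s := r - 1; have rE : r = 1 + s by rewrite /s; ring.
  have s0 : 0 <= s by rewrite /s; lra.
  have s49 : s <= 1 / 2 by rewrite /s; lra.
  have W0 : 0 <= r ^+ 2 - 1 by rewrite subr_ge0 exprn_ege1.
  (* [33/80] is a rational number just above [p^5 / 27 = (5 p + 3) / 27]. *)
  have BW : p ^+ 5 * (r ^+ 2 - 1) / 27 <= 33 / 80 * (r ^+ 2 - 1).
    by rewrite pE; nra.
  have BW0 : 0 <= p ^+ 5 * (r ^+ 2 - 1) / 27 by rewrite divr_ge0.
  apply: (@le_trans _ _ (4 * (1 + 33 / 80 * (r ^+ 2 - 1)) ^+ 3)).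
    by rewrite ler_pM2l// lerXn2r ?nnegrE ?lerD2l//; lra.
  rewrite -subr_ge0 rE.
  pose b : R := 33 / 80.
  (* Both sides equal 4 at [s = 0], whence the factor [s]; the cofactor is then bounded below term
     by term for [s] in [[0, 1/2]]. *)
  have -> : (1 + s) ^+ 2 * (1 + (1 + s)) ^+ 2 -
     4 * (1 + 33 / 80 * ((1 + s) ^+ 2 - 1)) ^+ 3 =
    s * (12 - 24 * b + s * (13 - 12 * b - 48 * b ^+ 2)
      + s ^+ 2 * (6 - 48 * b ^+ 2 - 32 * b ^+ 3)
      + s ^+ 3 * (1 - 12 * b ^+ 2 - 48 * b ^+ 3)
      - s ^+ 4 * (24 * b ^+ 3) - s ^+ 5 * (4 * b ^+ 3)).
    by rewrite /b; field.
  have h k : 0 <= s ^+ k <= (1 / 2) ^+ k.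
    by rewrite exprn_ge0// lerXn2r ?nnegrE//; lra.
  have := h 2; have := h 3; have := h 4; have := h 5.
  move=> /andP[_ h5] /andP[_ h4] /andP[_ h3] /andP[_ h2].
  by rewrite mulr_ge0 // /b; lra.
have A135 : 27 / 2 <= p ^+ 5 * (r ^+ 2 - 1).
  have : 5 / 4 <= r ^+ 2 - 1 by nra.
  by rewrite pE; nra.
apply: (@le_trans _ _ (p ^+ 5 * (r ^+ 2 - 1))).
  move: A135; set A := p ^+ 5 * _ => A135.
  rewrite -subr_ge0.
  have -> : A - (1 - u) ^+ 2 * (A + 27 * u) =
     u * ((A - 27 / 2) * (2 - u) + 27 / 2 * u * (3 - 2 * u)) by field.
  by rewrite mulr_ge0// addr_ge0 ?mulr_ge0//; lra.
have -> : p ^+ 5 * (r ^+ 2 - 1) = p ^+ 5 * (r - 1) * (r + 1) by ring.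
have -> : r ^+ 2 * (1 + r) ^+ 2 = r ^+ 2 * (r + 1) * (r + 1) by ring.
by rewrite ler_wpM2r ?golden_cubic//; lra.
Qed.

(* With [p = l + eta], [q = u + eta] and [m = a + eta], the left-hand side is
   [eta ^ 2] times the gap between [1 / m] and its chord on [[p, q]], which is
   largest at [m = sqrt (p q)]. *)
Lemma chord_gap (R : realType) (p l u a eta : R) :
  p ^+ 2 = p + 1 -> 0 <= p -> 0 < l -> l <= u -> 0 < a -> 0 < eta ->
  a * eta / (a + eta) -
    (eta - eta ^+ 2 * (l + u - a + eta) / ((l + eta) * (u + eta))) <=
  (u - l) ^+ 2 / (p ^+ 5 * (u - l) + 27 * l).
Proof.
move=> p2 p0 l0 lu a0 e0.
pose P : R := Num.sqrt (l + eta); pose Q : R := Num.sqrt (u + eta).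
have P0 : 0 < P by rewrite sqrtr_gt0; lra.
have Q0 : 0 < Q by rewrite sqrtr_gt0; lra.
have PP : P ^+ 2 = l + eta by rewrite sqr_sqrtr//; lra.
have QQ : Q ^+ 2 = u + eta by rewrite sqr_sqrtr//; lra.
have PQ : P <= Q by rewrite ler_sqrt; lra.
have etaE : eta = P ^+ 2 - l by rewrite PP; ring.
have uE : u = Q ^+ 2 - P ^+ 2 + l by rewrite PP QQ; ring.
have m0 : 0 < a + eta by lra.
have p5 : 0 <= p ^+ 5 by rewrite exprn_ge0.
have D0 : 0 < p ^+ 5 * (u - l) + 27 * l.
  by rewrite ltr_wpDl ?mulr_ge0//; lra.
(* Completing the square in [m = a + eta]: the value at [m = P Q], minus a nonnegative term that is
   dropped below. *)
have -> : a * eta / (a + eta) -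
    (eta - eta ^+ 2 * (l + u - a + eta) / ((l + eta) * (u + eta))) =
  (eta * (Q - P) / (P * Q)) ^+ 2 -
  eta ^+ 2 * (a + eta - P * Q) ^+ 2 / ((a + eta) * (P * Q) ^+ 2).
  rewrite -PP -QQ.
  have -> : l + u - a + eta = P ^+ 2 + Q ^+ 2 - (a + eta) by rewrite PP QQ; ring.
  have -> : a * eta = (a + eta) * eta - eta ^+ 2 by ring.
  move: m0; set m := a + eta => m0; field.
  by rewrite !gt_eqF.
rewrite lerBlDr; apply: (@le_trans _ _ ((u - l) ^+ 2 / (p ^+ 5 * (u - l) + 27 * l))).
  rewrite ler_pdivlMr// expr_div_n mulrAC ler_pdivrMr ?exprn_gt0 ?mulr_gt0//.
  have -> : u - l = (Q - P) * (Q + P) by rewrite uE; ring.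
  rewrite !exprMn mulrAC -mulrA [leRHS]mulrAC [X in X <= _]mulrC.
  rewrite [leRHS](_ : _ = (Q - P) ^+ 2 * (P ^+ 2 * Q ^+ 2 * (Q + P) ^+ 2)); last by ring.
  rewrite [leLHS](_ : _ =
    (Q - P) ^+ 2 * (eta ^+ 2 * (p ^+ 5 * (Q ^+ 2 - P ^+ 2) + 27 * l))); last by ring.
  rewrite ler_wpM2l ?sqr_ge0//.
  (* With [r = Q / P] and [u = l / P^2], one has [eta = P^2 (1 - u)], and the claim is
     [golden_kernel] scaled by [P^6]. *)
  have r1 : 1 <= Q / P by rewrite ler_pdivlMr// mul1r.
  have u01 : 0 <= l / P ^+ 2 <= 1.
    apply/andP; split; first by rewrite divr_ge0 ?sqr_ge0 ?ltW.
    by rewrite ler_pdivrMr ?exprn_gt0// mul1r PP; lra.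
  have := golden_kernel p2 p0 r1 u01.
  rewrite -(ler_pM2l (exprn_gt0 6 P0)) [leRHS](_ : _ = P ^+ 2 * Q ^+ 2 * (Q + P) ^+ 2).
    by apply: le_trans; rewrite le_eqVlt etaE; apply/orP; left; apply/eqP; field; rewrite gt_eqF.
  by field; rewrite gt_eqF.
by rewrite lerDl; apply: divr_ge0; apply: mulr_ge0; rewrite ?sqr_ge0 ?ltW.
Qed.

(** * Euclidean geometry and Rayleigh quotients *)

Section Inner.
Variables (R : realType) (n : nat).
Implicit Types (u v w x y : 'cV[R]_n) (A H : 'M[R]_n).

Lemma innerE u v : inner u v = \sum_i u i 0 * v i 0.
Proof. by rewrite /inner mxE; apply: eq_bigr => i _; rewrite mxE. Qed.

Lemma innerC u v : inner u v = inner v u.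
Proof. by rewrite !innerE; apply: eq_bigr => i _; rewrite mulrC. Qed.

Lemma innerDr u v w : inner u (v + w) = inner u v + inner u w.
Proof. by rewrite /inner mulmxDr mxE. Qed.

Lemma innerZr (a : R) u v : inner u (a *: v) = a * inner u v.
Proof. by rewrite /inner -scalemxAr mxE. Qed.

Lemma innerDl u v w : inner (u + v) w = inner u w + inner v w.
Proof. by rewrite innerC innerDr !(innerC w). Qed.

Lemma innerZl (a : R) u v : inner (a *: u) v = a * inner u v.
Proof. by rewrite innerC innerZr innerC. Qed.

Lemma innerNr u v : inner u (- v) = - inner u v.
Proof. by rewrite -scaleN1r innerZr mulN1r. Qed.

Lemma innerNl u v : inner (- u) v = - inner u v.
Proof. by rewrite innerC innerNr innerC. Qed.

Lemma inner0r u : inner u 0 = 0.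
Proof. by rewrite -(scale0r 0) innerZr mul0r. Qed.

Lemma inner0l u : inner 0 u = 0.
Proof. by rewrite innerC inner0r. Qed.

Definition inner_linE :=
  (innerDr, innerDl, innerNr, innerNl, innerZr, innerZl, inner0r, inner0l).

Lemma inner_ge0 u : 0 <= inner u u.
Proof. by rewrite innerE sumr_ge0// => i _; rewrite -expr2 sqr_ge0. Qed.

Lemma inner_eq0 u : (inner u u == 0) = (u == 0).
Proof.
rewrite innerE psumr_eq0 => [|i _]; last by rewrite -expr2 sqr_ge0.
apply/allP/eqP => [h|-> i _]; last by rewrite /= mxE mul0r.
apply/colP => i; rewrite mxE; have /= := h i (mem_index_enum i).
by rewrite mulf_eq0 orbb => /eqP.
Qed.

Lemma inner_gt0 u : (0 < inner u u) = (u != 0).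
Proof. by rewrite lt_def inner_ge0 andbT inner_eq0. Qed.

Lemma norm2_sqr u : norm2 u ^+ 2 = inner u u.
Proof.
rewrite sqr_sqrtr ?sumr_ge0// => [|i _]; last by rewrite sqr_ge0.
by rewrite innerE; apply: eq_bigr => i _; rewrite expr2.
Qed.

Lemma norm2_ge0 u : 0 <= norm2 u. Proof. exact: sqrtr_ge0. Qed.

Lemma norm2E u : norm2 u = Num.sqrt (inner u u).
Proof. by rewrite -norm2_sqr sqrtr_sqr ger0_norm// norm2_ge0. Qed.

Lemma norm2_eq0 u : (norm2 u == 0) = (u == 0).
Proof. by rewrite -inner_eq0 -norm2_sqr sqrf_eq0. Qed.

Lemma norm2_gt0 u : (0 < norm2 u) = (u != 0).
Proof. by rewrite lt_def norm2_eq0 norm2_ge0 andbT. Qed.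

Lemma norm20 : norm2 (0 : 'cV[R]_n) = 0.
Proof. by apply/eqP; rewrite norm2_eq0. Qed.

Lemma norm2Z (a : R) u : norm2 (a *: u) = `|a| * norm2 u.
Proof. by rewrite !norm2E !inner_linE mulrA -expr2 sqrtrM ?sqr_ge0// sqrtr_sqr. Qed.

(** The case [c = 0] is included because the quadratic form it is applied to is only
    semidefinite. *)
Lemma quadratic_discr (a b c : R) : 0 <= c ->
  (forall t, 0 <= a + 2 * t * b + t ^+ 2 * c) -> b ^+ 2 <= a * c.
Proof.
rewrite le_eqVlt => /predU1P[<-|c0] h.
  have [->|b0] := eqVneq b 0; first by rewrite expr0n mulr0.
  have := h (- (a + 1) / (2 * b)).
  rewrite mulr0 addr0 (_ : a + _ = - 1); last by field.
  by rewrite oppr_ge0 ler10.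
have := h (- b / c); rewrite -(pmulr_lge0 _ c0) (_ : (_ + _) * c = a * c - b ^+ 2).
  by rewrite subr_ge0.
by field; rewrite gt_eqF.
Qed.

Lemma inner_mulmxA A u v : A^T = A -> inner u (A *m v) = inner (A *m u) v.
Proof. by move=> sA; rewrite /inner trmx_mul sA mulmxA. Qed.

Lemma psd_cauchy_schwarz A u v : A^T = A -> (forall w, 0 <= inner w (A *m w)) ->
  inner u (A *m v) ^+ 2 <= inner u (A *m u) * inner v (A *m v).
Proof.
move=> sA A0; apply: quadratic_discr => // t.
have := A0 (u + t *: v); rewrite mulmxDr -scalemxAr !inner_linE.
rewrite [inner v (A *m u)]inner_mulmxA// [inner (A *m v) u]innerC.
by move=> /le_trans; apply; rewrite le_eqVlt; apply/orP; left; apply/eqP; ring.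
Qed.

Lemma cauchy_schwarz u v : inner u v ^+ 2 <= inner u u * inner v v.
Proof.
have := @psd_cauchy_schwarz 1%:M u v (trmx1 _ _); rewrite !mul1mx; apply => w.
by rewrite mul1mx inner_ge0.
Qed.

Lemma inner_le_norm2 u v : `|inner u v| <= norm2 u * norm2 v.
Proof.
rewrite -[leRHS]ger0_norm ?mulr_ge0 ?norm2_ge0// -ler_sqr ?nnegrE//.
by rewrite -!normrX !ger0_norm ?sqr_ge0// exprMn !norm2_sqr cauchy_schwarz.
Qed.

Lemma norm2_triangle u v : norm2 (u + v) <= norm2 u + norm2 v.
Proof.
rewrite -ler_sqr ?nnegrE ?addr_ge0 ?norm2_ge0// sqrrD !norm2_sqr !inner_linE.
have := le_trans (ler_norm _) (inner_le_norm2 u v).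
by rewrite (innerC v u); lra.
Qed.

(** The operator inequality [A^2 <= d A], without diagonalising: Cauchy-Schwarz for the form [A] at
    [A y] and [y] gives [|A y|^4 <= d |A y|^2 inner y (A y)]. *)
Lemma psd_sqr_le A (d : R) y : A^T = A ->
  (forall w, 0 <= inner w (A *m w) <= d * inner w w) ->
  inner (A *m y) (A *m y) <= d * inner y (A *m y).
Proof.
move=> sA hA; have A0 w : 0 <= inner w (A *m w) by case/andP: (hA w).
set z := A *m y.
have [z0|z0] := eqVneq z 0.
  by rewrite z0 inner0l inner0r mulr0.
have := psd_cauchy_schwarz z y sA A0; rewrite -/z => h.
rewrite -(ler_pM2l (_ : 0 < inner z z)) ?inner_gt0// -expr2.
apply: le_trans h _; rewrite mulrA [inner z z * d]mulrC ler_wpM2r//.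
by case/andP: (hA z).
Qed.

Lemma mulmx_norm_bound A : exists2 K : R, 0 < K &
  forall v, inner (A *m v) (A *m v) <= K * inner v v.
Proof.
exists (1 + \sum_i inner (row i A)^T (row i A)^T).
  by rewrite ltr_pwDl// sumr_ge0// => i _; rewrite inner_ge0.
move=> v; rewrite mulrDl mul1r ler_wpDl ?inner_ge0// mulr_suml [leLHS]innerE.
apply: ler_sum => i _; rewrite -expr2; apply: le_trans (cauchy_schwarz _ _).
rewrite innerE mxE le_eqVlt; apply/orP; left; apply/eqP; congr (_ ^+ 2).
by apply: eq_bigr => j _; rewrite !mxE.
Qed.

Lemma quadform_bound A : exists2 K : R, 0 < K &
  forall v, `|inner v (A *m v)| <= K * inner v v.
Proof.
have [K K0 hK] := mulmx_norm_bound A; exists (1 + K); first lra.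
move=> v; apply: le_trans (inner_le_norm2 _ _) _.
have : 2 * (norm2 v * norm2 (A *m v)) <= inner v v + inner (A *m v) (A *m v).
  have := sqr_ge0 (norm2 v - norm2 (A *m v)); rewrite sqrrB !norm2_sqr; lra.
have := hK v; have := inner_ge0 v; have := inner_ge0 (A *m v).
have : 0 <= K * inner v v by rewrite mulr_ge0 ?inner_ge0// ltW.
lra.
Qed.

(** With [K] bounding the inverse and [d] the form, [|v|^2 <= K |A v|^2 <= K d inner v (A v)], the
    last step by [psd_sqr_le]. *)
Lemma psd_unit_coercive A : A^T = A -> (forall w, 0 <= inner w (A *m w)) ->
  A \in unitmx -> exists2 c : R, 0 < c & forall v, c * inner v v <= inner v (A *m v).
Proof.
move=> sA A0 uA; have [K K0 hK] := mulmx_norm_bound (invmx A).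
have [d d0 hd] := quadform_bound A.
exists (K * d)^-1; first by rewrite invr_gt0 mulr_gt0.
move=> v; rewrite mulrC ler_pdivrMr ?mulr_gt0//.
have := hK (A *m v); rewrite mulKmx// => /le_trans; apply.
rewrite mulrCA ler_pM2l// [leRHS]mulrC.
apply: psd_sqr_le => // w; rewrite A0/=.
exact: le_trans (ler_norm _) (hd w).
Qed.

Lemma eigenvalue_unitmx A (a : R) : eigenvalue A a = (A - a%:M \notin unitmx).
Proof. by rewrite /eigenvalue /eigenspace kermx_eq0 row_free_unit. Qed.

(** Eigenvectors are rows in [eigenvalueP]; symmetry turns them into columns. *)
Lemma eigenvalueP_cV A (a : R) : A^T = A ->
  reflect (exists2 v : 'cV[R]_n, A *m v = a *: v & v != 0) (eigenvalue A a).
Proof.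
move=> sA; apply: (iffP eigenvalueP) => -[v vA v0].
  exists v^T; last by rewrite trmx_eq0.
  by rewrite -{1}sA -trmx_mul vA linearZ.
exists v^T; last by rewrite trmx_eq0.
by rewrite -{1}sA -trmx_mul vA linearZ.
Qed.

(* The infimum [m] of the Rayleigh quotient is an eigenvalue: were [A - m]
   invertible, it would be coercive and [m] would not be the infimum. *)
Lemma rayleigh_min A (l : R) v : A^T = A -> min_eigenvalue A l ->
  l * inner v v <= inner v (A *m v).
Proof.
move=> sA [/(eigenvalueP_cV _ sA)[e eA e0] lmin].
have [d d0 hd] := quadform_bound A.
pose S := [set inner w (A *m w) / inner w w | w in [set w : 'cV[R]_n | w != 0]].
have S0 : S !=set0 by exists (inner e (A *m e) / inner e e), e.
have Slb : lbound S (- d).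
  move=> _ [w /= w0 <-]; rewrite ler_pdivlMr ?inner_gt0// mulNr lerNl.
  by apply: le_trans (hd w); rewrite -normrN ler_norm.
have Sinf : has_inf S by split => //; exists (- d).
pose m := inf S.
have mP w : m * inner w w <= inner w (A *m w).
  have [->|w0] := eqVneq w 0; first by rewrite !inner_linE mulr0.
  rewrite -ler_pdivlMr ?inner_gt0//; apply: ge_inf; first by exists (- d).
  by exists w.
suff em : eigenvalue A m.
  by apply: le_trans (mP v); rewrite ler_wpM2r ?inner_ge0 ?lmin.
rewrite eigenvalue_unitmx; apply/negP => um.
have mE w : inner w ((A - m%:M) *m w) = inner w (A *m w) - m * inner w w.
  by rewrite mulmxBl mul_scalar_mx !inner_linE.
have [||c c0 hc] := psd_unit_coercive _ _ um.
- by rewrite linearB/= sA tr_scalar_mx.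
- by move=> w; rewrite mE subr_ge0.
have : m + c <= m.
  apply: lb_le_inf => // _ [w /= w0 <-].
  rewrite ler_pdivlMr ?inner_gt0// mulrDl addrC -lerBrDr -mE; exact: hc.
by rewrite gerDl leNgt c0.
Qed.

Lemma rayleigh_max A (u : R) v : A^T = A -> max_eigenvalue A u ->
  inner v (A *m v) <= u * inner v v.
Proof.
move=> sA [eu umax].
have sNA : (- A)^T = - A by rewrite linearN/= sA.
have eN b : eigenvalue (- A) b = eigenvalue A (- b).
  apply/(eigenvalueP_cV _ sNA)/(eigenvalueP_cV _ sA) => -[w wA w0]; exists w => //.
    by rewrite -[A]opprK mulNmx wA scaleNr.
  by rewrite mulNmx wA scaleNr opprK.
have := @rayleigh_min (- A) (- u) v sNA; rewrite mulNmx innerNr mulNr lerN2.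
apply; split; first by rewrite eN opprK.
by move=> b; rewrite eN lerNl => /umax.
Qed.

(* Spectrally, the minimum over [x] of the left-hand side is
   [\sum_i w_i lambda_i eta / (lambda_i + eta)]; the right-hand side replaces the
   concave function [lambda |-> lambda eta / (lambda + eta)] by its chord on
   [[l, u]]. *)
Lemma quadform_chord A (l u eta : R) x0 x : A^T = A -> 0 < l -> l <= u -> 0 < eta ->
  (forall w, l * inner w w <= inner w (A *m w) <= u * inner w w) ->
  eta * inner x0 x0 - eta ^+ 2 / ((l + eta) * (u + eta)) *
    ((l + u + eta) * inner x0 x0 - inner x0 (A *m x0)) <=
  inner (x - x0) (A *m (x - x0)) + eta * inner x x.
Proof.
move=> sA l0 lu e0 hA.
pose M := A + eta%:M.
have sM : M^T = M by rewrite linearD/= sA tr_scalar_mx.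
have ME w : M *m w = A *m w + eta *: w by rewrite mulmxDl mul_scalar_mx.
have uM : M \in unitmx.
  have : ~~ eigenvalue M 0.
    apply/negP => /(eigenvalueP_cV _ sM)[w wM w0].
    have := congr1 (inner w) wM; rewrite ME scale0r !inner_linE => h.
    have /andP[hl _] := hA w; have w1 : 0 < inner w w by rewrite inner_gt0.
    have : 0 < eta * inner w w by rewrite mulr_gt0.
    have : 0 < l * inner w w by rewrite mulr_gt0.
    lra.
  by rewrite eigenvalue_unitmx negbK -scalemx1 scale0r subr0.
(* The right-hand side is minimal at [x = A y]; [z] is the deviation from that minimiser, and the
   scalars [s0] to [s3] below are the moments [inner y (A^k y)]. *)
pose y := invmx M *m x0.
have x0E : x0 = A *m y + eta *: y by rewrite -ME mulKVmx.
pose z := x - x0 + eta *: y.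
have xE : x = z + A *m y by rewrite /z [in - x0]x0E opprD addrA subrK subrK.
have xx0E : x - x0 = z - eta *: y by rewrite /z addrK.
clearbody z.
pose s0 := inner y y; pose s1 := inner y (A *m y).
pose s2 := inner (A *m y) (A *m y); pose s3 := inner (A *m y) (A *m (A *m y)).
have s02 : inner y (A *m (A *m y)) = s2 by rewrite inner_mulmxA.
pose B := A - l%:M.
have sB : B^T = B by rewrite linearB/= sA tr_scalar_mx.
have BE w : B *m w = A *m w - l *: w by rewrite mulmxBl mul_scalar_mx.
have hB w : 0 <= inner w (B *m w) <= (u - l) * inner w w.
  by have /andP[] := hA w; rewrite BE !inner_linE mulrBl => h1 h2; lra.
(* [F2] and [F3] are [B^2 <= (u - l) B] and [B^3 <= (u - l) B^2] at [y], written in moments; the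
   final gap is a nonnegative combination of their slacks. *)
have F2 : s2 - 2 * l * s1 + l ^+ 2 * s0 <= (u - l) * (s1 - l * s0).
  have := psd_sqr_le y sB hB; rewrite !BE !inner_linE -/s0 -/s1 -/s2.
  by rewrite [inner (A *m y) y]innerC -/s1 => h; lra.
have F3 : s3 - 3 * l * s2 + 3 * l ^+ 2 * s1 - l ^+ 3 * s0 <=
    (u - l) * (s2 - 2 * l * s1 + l ^+ 2 * s0).
  have /andP[_] := hB (B *m y); rewrite !BE !mulmxBr -!scalemxAr !inner_linE.
  rewrite [inner (A *m y) y]innerC -/s0 -/s1 -/s2 -/s3 s02.
  by move=> h; lra.
have x00 : inner x0 x0 = s2 + 2 * eta * s1 + eta ^+ 2 * s0.
  by rewrite x0E !inner_linE [inner (A *m y) y]innerC -/s0 -/s1 -/s2; ring.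
have x01 : inner x0 (A *m x0) = s3 + 2 * eta * s2 + eta ^+ 2 * s1.
  rewrite x0E mulmxDr -scalemxAr !inner_linE s02 -/s1 -/s2 -/s3; ring.
have -> : inner (x - x0) (A *m (x - x0)) + eta * inner x x =
    inner z (A *m z) + eta * inner z z + (eta ^+ 2 * s1 + eta * s2).
  rewrite xx0E [in inner x x]xE mulmxBr -scalemxAr !inner_linE.
  rewrite [inner y (A *m z)]inner_mulmxA// [inner (A *m y) z]innerC -/s1 -/s2.
  ring.
apply: ler_wpDl.
  apply: addr_ge0; last by rewrite mulr_ge0 ?inner_ge0 ?ltW.
  by have /andP[+ _] := hA z => /(le_trans _); apply; rewrite mulr_ge0 ?inner_ge0 ?ltW.
have p0 : 0 < l + eta by lra. have q0 : 0 < u + eta by lra.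
rewrite x00 x01 -subr_ge0.
set G := (X in 0 <= X).
have -> : G = eta ^+ 2 / ((l + eta) * (u + eta)) *
    (((u - l) * (s2 - 2 * l * s1 + l ^+ 2 * s0) -
      (s3 - 3 * l * s2 + 3 * l ^+ 2 * s1 - l ^+ 3 * s0)) +
     (l + eta) * ((u - l) * (s1 - l * s0) - (s2 - 2 * l * s1 + l ^+ 2 * s0))).
  by rewrite /G; field; rewrite !gt_eqF.
rewrite mulr_ge0//; first by rewrite divr_ge0 ?sqr_ge0// ltW ?mulr_gt0.
by rewrite addr_ge0 ?mulr_ge0 ?subr_ge0 ?(ltW p0).
Qed.

End Inner.

(** * Wasserstein duality *)

Section DiracSum.
Context (d : measure_display) (T : measurableType d) (R : realType) (J : finType).
Variables (w : J -> {nonneg R}) (z : J -> T).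

(** [msum] sums over naturals, hence the enumeration of [J]; the zero measure is only a default
    beyond the range summed. *)
Definition dirac_sum_term (k : nat) : {measure set T -> \bar R} :=
  if insub k is Some i
  then mscale (w (enum_val (i : 'I_#|J|))) (\d_(z (enum_val i)) : {measure set T -> \bar R})
  else mzero.

Definition dirac_sum : set T -> \bar R := msum dirac_sum_term #|J|.

HB.instance Definition _ := Measure.on dirac_sum.

Lemma dirac_sumE A : dirac_sum A = (\sum_j (w j)%:num%:E * \d_(z j) A)%E.
Proof.
rewrite /dirac_sum /msum [RHS](big_enum_val (A := J))/=.
by apply: eq_bigr => i _; rewrite /dirac_sum_term valK.
Qed.

Lemma ge0_integral_dirac_sum (f : T -> R) : measurable_fun setT f ->
  (forall x, 0 <= f x) ->
  (\int[dirac_sum]_x (f x)%:E = (\sum_j (w j)%:num * f (z j))%:E)%E.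
Proof.
move=> + f0 => /measurable_EFinP mf.
rewrite ge0_integral_measure_sum// => [|x _]; last by rewrite lee_fin.
rewrite -sumEFin [RHS](big_enum_val (A := J))/=.
apply: eq_bigr => i _; rewrite /dirac_sum_term valK.
rewrite ge0_integral_mscale//= => [|x _]; last by rewrite lee_fin.
by rewrite integral_dirac// diracT mul1e.
Qed.

Hypothesis w1 : \sum_j (w j)%:num = 1.

Let dirac_sum_setT : dirac_sum setT = 1%E.
Proof.
rewrite dirac_sumE; under eq_bigr do rewrite diracT mule1.
by rewrite sumEFin w1.
Qed.

(** The [let] makes the definition depend on [w1], so that a probability structure can be attached
    to it. *)
Definition dirac_sum_prob : set T -> \bar R := let _ := w1 in dirac_sum.

HB.instance Definition _ := Measure.on dirac_sum_prob.
HB.instance Definition _ := Measure_isProbability.Build _ _ _ dirac_sum_prob dirac_sum_setT.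

End DiracSum.

(** * Measurability and integration along marginals *)

Section Measurability.
Variables (R : realType) (n : nat).
Local Notation E := (borel_cV R n).

Lemma measurable_coord (i : 'I_n) :
  measurable_fun [set: E] (fun v : E => (v : 'cV[R]_n) i 0 : R).
Proof.
apply: (measurability _ (RGenOpens.measurableE R)) => _ [_ [a [b ->]] <-].
rewrite setTI; apply: sub_sigma_algebra.
have /continuousP := @coord_continuous R n 1 i 0.
apply; exact: interval_open.
Qed.

Lemma measurable_inner (x : 'cV[R]_n) :
  measurable_fun [set: E] (fun v : E => inner (v : 'cV[R]_n) x).
Proof.
rewrite (_ : (fun _ => _) = (fun v : E => \sum_i (v : 'cV[R]_n) i 0 * x i 0)).
  by apply: measurable_sum => i; apply: measurable_funM => //; exact: measurable_coord.
by apply/funext => v; rewrite innerE.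
Qed.

(** Measurability is for the product sigma-algebra, hence argued coordinate by coordinate rather
    than from continuity on the product. *)
Lemma measurable_norm2B :
  measurable_fun [set: E * E] (fun p : E * E => norm2 (p.1 - p.2 : 'cV[R]_n)).
Proof.
pose h (p : E * E) := \sum_i ((p.1 : 'cV[R]_n) i 0 - (p.2 : 'cV[R]_n) i 0) ^+ 2.
rewrite (_ : (fun _ => _) = Num.sqrt \o h); last first.
  by apply/funext => p; rewrite /norm2 /h/=; congr Num.sqrt;
    apply: eq_bigr => i _; rewrite !mxE.
apply: measurableT_comp.
  by apply: continuous_measurable_fun; exact: sqrt_continuous.
apply: measurable_sum => i; apply: measurable_funX.
apply: measurable_funB.
  exact: (measurableT_comp (measurable_coord i) measurable_fst).
exact: (measurableT_comp (measurable_coord i) measurable_snd).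
Qed.

End Measurability.

(** Change of variables, applied to the two projections of a coupling. *)
Lemma ge0_integral_marginal (d1 d2 : measure_display) (T1 : measurableType d1)
    (T2 : measurableType d2) (R : realType)
    (phi : T1 -> T2) (P : {measure set T2 -> \bar R})
    (pi : {measure set T1 -> \bar R}) (f : T2 -> R) :
  measurable_fun setT phi -> (forall A, measurable A -> P A = pi (phi @^-1` A)) ->
  measurable_fun setT f -> (forall x, 0 <= f x) ->
  (\int[P]_x (f x)%:E = \int[pi]_x (f (phi x))%:E)%E.
Proof.
move=> mphi mE mf f0.
transitivity (\int[pushforward pi phi]_x (f x)%:E)%E.
  by apply: eq_measure_integral => A mA _; rewrite mE.
rewrite ge0_integral_pushforward//.
- exact/measurable_EFinP.
- by move=> x _; rewrite lee_fin.
Qed.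

(** * Slopes of convex Lipschitz functions *)

Section Slope.
Variables (R : realType) (L : R -> R).
Hypothesis Lconv : convex_function (setT : set R^o) (L : R^o -> R^o).

Lemma convex_functionTE (t x y : R) : 0 <= t <= 1 ->
  L (t * x + (1 - t) * y) <= t * L x + (1 - t) * L y.
Proof.
move=> /andP[t0 t1].
have := @Lconv (Itv01 t0 t1) x y; rewrite !inE => /(_ Logic.I Logic.I).
by rewrite !convRE.
Qed.

(** Multiplied out by [z - x], so that the degenerate case [x = y = z] is covered. *)
Lemma convex_chord (x y z : R) : x <= y <= z ->
  (z - x) * L y <= (z - y) * L x + (y - x) * L z.
Proof.
move=> /andP[xy yz].
have [zx|xz] := leP z x.
  have -> : y = x by lra.
  have -> : z = x by lra.
  by rewrite !subrr !mul0r addr0.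
have zx0 : 0 < z - x by rewrite subr_gt0.
have t01 : 0 <= (z - y) / (z - x) <= 1.
  by apply/andP; split; [rewrite divr_ge0; lra|rewrite ler_pdivrMr; lra].
have := convex_functionTE x z t01.
rewrite (_ : _ / _ * x + _ = y); last by field; rewrite gt_eqF.
rewrite -(ler_pM2l zx0) => /le_trans; apply.
by rewrite le_eqVlt; apply/orP; left; apply/eqP; field; rewrite gt_eqF.
Qed.

Variable K : R.
Hypothesis Llip : forall x y, `|L x - L y| <= K * `|x - y|.

Definition slopes : set R :=
  [set s | exists x y, y < x /\ s = `|L x - L y| / (x - y)].

(** The least Lipschitz constant of a Lipschitz [L]. *)
Definition max_slope := sup slopes.

Lemma has_sup_slopes : has_sup slopes.
Proof.
split; first by exists (`|L 1 - L 0| / (1 - 0)), 1, 0.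
exists K => _ [x [y [yx ->]]]; rewrite ler_pdivrMr ?subr_gt0//.
by apply: le_trans (Llip x y) _; rewrite gtr0_norm ?subr_gt0.
Qed.

Lemma max_slope_ge0 : 0 <= max_slope.
Proof.
apply: (@le_trans _ _ (`|L 1 - L 0| / (1 - 0))); first by rewrite divr_ge0 ?subr0.
by apply: sup_upper_bound; [exact: has_sup_slopes|exists 1, 0].
Qed.

Lemma max_slope_lip x y : `|L x - L y| <= max_slope * `|x - y|.
Proof.
wlog yx : x y / y < x.
  move=> h; have [yx|xy|->] := ltgtP y x; first exact: h.
    by rewrite distrC [`|x - y|]distrC; exact: h.
  by rewrite !subrr normr0 mulr0.
rewrite [`|x - y|]gtr0_norm ?subr_gt0// -ler_pdivrMr ?subr_gt0//.
by apply: sup_upper_bound; [exact: has_sup_slopes|exists x, y].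
Qed.

(* A convex function attains its largest slope at infinity, in one of the two
   directions [s]. *)
Lemma asymptotic_slope (m : R) : m < max_slope -> exists s C B : R,
  `|s| = 1 /\ forall v, B <= s * v -> C + m * (s * v) <= L v.
Proof.
move=> mM; have e0 : 0 < max_slope - m by rewrite subr_gt0.
have [_ [y [x [xy ->]]]] := sup_adherent e0 has_sup_slopes.
rewrite -/max_slope opprB addrC subrK ltr_pdivlMr ?subr_gt0// => h.
(* The chord over [[x, y]] is steeper than [m]; by convexity [L] keeps growing at rate at least [m]
   past its higher end, to the right or to the left. *)
have [yx0|xy0] := leP (L x) (L y).
  exists 1, (L y - m * y), y; split; first by rewrite normr1.
  move=> v; rewrite !mul1r => yv.
  have := @convex_chord x y v; rewrite (ltW xy) yv => /(_ isT) c.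
  move: h; rewrite ger0_norm ?subr_ge0// => h.
  have xy' : 0 < y - x by rewrite subr_gt0.
  rewrite -(ler_pM2l xy').
  have : (v - y) * (m * (y - x)) <= (v - y) * (L y - L x).
    by rewrite ler_wpM2l ?subr_ge0// ltW.
  lra.
exists (-1), (L x + m * x), (- x); split; first by rewrite normrN1.
move=> v; rewrite !mulN1r lerN2 => vx.
have := @convex_chord v x y; rewrite (ltW xy) vx => /(_ isT) c.
move: h; rewrite ltr0_norm ?subr_lt0// => h.
have xy' : 0 < y - x by rewrite subr_gt0.
rewrite -(ler_pM2l xy').
have : (x - v) * (m * (y - x)) <= (x - v) * (- (L y - L x)).
  by rewrite ler_wpM2l ?subr_ge0// ltW.
lra.
Qed.

End Slope.

(** * Two-sided bounds on the worst-case risk *)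

Section Duality.
Variables (R : realType) (I : instance R).
Local Notation n := (Defs.dim I).
Local Notation N := (nsamples I).
Local Notation xi := (@sample R I).
Local Notation L := (lossfun I).
Local Notation E := (borel_cV R n).

Hypothesis N_gt0 : (0 < N)%N.
Hypothesis L_ge0 : forall z, 0 <= L z.
Hypothesis Lconv : convex_function (setT : set R^o) (L : R^o -> R^o).
Variable K : R.
Hypothesis Llip : forall x y, `|L x - L y| <= K * `|x - y|.
Hypothesis mL : measurable_fun setT L.

Let N0 : 0 < N%:R :> R. Proof. by rewrite ltr0n. Qed.
Let Nn0 : N%:R != 0 :> R. Proof. by rewrite gt_eqF. Qed.

Lemma measurable_loss (x : 'cV[R]_n) : measurable_fun [set: E] (loss x : E -> R).
Proof. exact: (measurableT_comp mL (measurable_inner x)). Qed.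

Lemma empiricalE A :
  empirical xi A = dirac_sum (fun=> NngNum (ltW (divr_gt0 ltr01 N0))) (xi : 'I_N -> E) A.
Proof.
rewrite dirac_sumE /empirical ge0_sume_distrr//.
  by apply: eq_bigr => i _; rewrite /= div1r.
Qed.

Lemma integral_empirical (x : 'cV[R]_n) :
  (\int[empirical xi]_z (loss x z)%:E = (emp_loss x)%:E)%E.
Proof.
rewrite (eq_measure_integral (dirac_sum
  (fun=> NngNum (ltW (divr_gt0 ltr01 N0))) (xi : 'I_N -> E))); last first.
  by move=> A _ _; exact: empiricalE.
rewrite (ge0_integral_dirac_sum _ _ (measurable_loss x)) => [|z]; last exact: L_ge0.
by rewrite -mulr_sumr/= div1r.
Qed.

Lemma lip_ge0 : 0 <= K.
Proof. by have := le_trans (normr_ge0 _) (Llip 1 0); rewrite subr0 normr1 mulr1. Qed.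

Lemma loss_lip (x z z' : 'cV[R]_n) :
  loss x z <= loss x z' + K * norm2 x * norm2 (z - z').
Proof.

rewrite -lerBlDl; apply: le_trans (ler_norm _) _; apply: le_trans (Llip _ _) _.
rewrite -mulrA ler_wpM2l ?lip_ge0// (_ : _ - _ = inner (z - z') x).
  by rewrite mulrC inner_le_norm2.
by rewrite !inner_linE.
Qed.

(** The Lipschitz bound [loss_lip] is integrated against a nearly optimal coupling: the marginals
    yield the two expectations, the cost yields the penalty. *)
Lemma expectation_wball_le rho (x : 'cV[R]_n) (Q : probability E R) : wball rho Q ->
  ('E_Q[loss x] <= (emp_loss x + K * norm2 x * rho)%:E)%E.
Proof.
rewrite unlock /wball/= => Qrho; apply/lee_addgt0Pr => e e0.
have Kx0 : 0 <= K * norm2 x by rewrite mulr_ge0 ?lip_ge0 ?norm2_ge0.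
(* Slack on the cost, since the infimum over couplings need not be attained; [+ 1] guards against
   [K * norm2 x = 0]. *)
pose dl := e / (K * norm2 x + 1).
have dl0 : 0 < dl by rewrite divr_gt0// ltr_wpDl.
have : (wasserstein1 Q (empirical xi) < (rho + dl)%:E)%E.
  by apply: le_lt_trans Qrho _; rewrite lte_fin ltrDl.
move=> /ereal_inf_lt[_ [pi cpi <-]] cost.
have mloss := measurable_loss x.
have l0 z : 0 <= loss x z by exact: L_ge0.
have piQ A : measurable A -> Q A = pi (fst @^-1` A).
  move=> mA; have [<- _] := cpi _ mA; congr (pi _).
  by apply/seteqP; split => [p []|p].
have piP A : measurable A -> empirical xi A = pi (snd @^-1` A).
  move=> mA; have [_ <-] := cpi _ mA; congr (pi _).
  by apply/seteqP; split => [p []|p].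
rewrite (ge0_integral_marginal measurable_fst piQ mloss l0).
pose f p := ((loss x p.2)%:E + (K * norm2 x)%:E * (norm2 (p.1 - p.2 : 'cV[R]_n))%:E : \bar R)%E.
have ml1 : measurable_fun [set: E * E] (fun p : E * E => (loss x p.1)%:E).
  by apply/measurable_EFinP; exact: (measurableT_comp mloss measurable_fst).
have ml2 : measurable_fun [set: E * E] (fun p : E * E => (loss x p.2)%:E).
  by apply/measurable_EFinP; exact: (measurableT_comp mloss measurable_snd).
have mN : measurable_fun [set: E * E]
    (fun p : E * E => (norm2 (p.1 - p.2 : 'cV[R]_n))%:E).
  by apply/measurable_EFinP; exact: measurable_norm2B.
have mKN : measurable_fun [set: E * E]
    (fun p : E * E => (K * norm2 x)%:E * (norm2 (p.1 - p.2 : 'cV[R]_n))%:E)%E.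
  exact: emeasurable_funM.
apply: (@le_trans _ _ (\int[pi]_p f p)%E).
  apply: ge0_le_integral => //.
  - by move=> p _; rewrite lee_fin L_ge0.
  - exact: emeasurable_funD.
  - by move=> p _; rewrite /f lee_fin loss_lip.
rewrite ge0_integralD//; first last.
- by move=> p _; rewrite lee_fin mulr_ge0 ?norm2_ge0.
- by move=> p _; rewrite lee_fin L_ge0.
rewrite ge0_integralZl_EFin//; last by move=> p _; rewrite lee_fin norm2_ge0.
rewrite -(ge0_integral_marginal measurable_snd piP mloss l0).
rewrite integral_empirical.
apply: (@le_trans _ _ ((emp_loss x)%:E + (K * norm2 x)%:E * (rho + dl)%:E)%E).
  by rewrite leeD2l// lee_wpmul2l ?lee_fin// ltW.
rewrite -EFinM -!EFinD lee_fin mulrDr addrA lerD2l /dl mulrCA.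
by apply: ler_piMr; rewrite ?(ltW e0)// ler_pdivrMr ?ltr_wpDl//; lra.
Qed.

(** The adversary moves a fraction [al] of the mass of every sample by at most [rho / al] along [x],
    in the direction [s] of steep growth, at cost at most [rho]. *)
Lemma frho_ge rho (x : 'cV[R]_n) (m : R) : 0 <= rho -> m < max_slope L ->
  ((emp_loss x + m * norm2 x * rho)%:E <= frho rho x)%E.
Proof.
move=> rho0 mM; have [s [C [B [s1 hL]]]] := asymptotic_slope Lconv Llip mM.
apply/lee_addgt0Pr => e e0.
pose D := `|emp_loss x - C - m * s * (N%:R^-1 * \sum_i inner (xi i) x)| + 1.
pose G := 1 + `|B| + \sum_i `|inner (xi i) x|.
have D0 : 0 < D by rewrite ltr_wpDl.
have G0 : 0 < G.
  by rewrite ltr_pwDl ?ltr_pwDl ?sumr_ge0.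
(* The default 1 keeps [al] positive when [rho * norm2 x = 0], a case in which the displacement
   leaves every loss unchanged. *)
pose nrho := if rho * norm2 x == 0 then 1 else rho * norm2 x.
have nrho0 : 0 < nrho.
  by rewrite /nrho; case: eqVneq => // h; rewrite lt_def h mulr_ge0 ?norm2_ge0.
(* [al <= 1] makes the weights nonnegative, [al * D <= e] absorbs the constants of the affine
   minorant, and [al * G <= nrho] sends every moved sample past the threshold [B]. *)
pose al := Num.min 1 (Num.min (e / D) (nrho / G)).
have al0 : 0 < al by rewrite !lt_min ltr01 !divr_gt0.
have al1 : al <= 1 by rewrite ge_min lexx.
have ale : al * D <= e by rewrite -ler_pdivlMr// !ge_min lexx orbT.
have alG : al * G <= nrho by rewrite -ler_pdivlMr// !ge_min lexx !orbT.
(* The boolean tells the moved part of a sample's mass from the part left in place. *)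
pose J := (bool * 'I_N)%type.
pose wt (j : J) : R := if j.1 then al / N%:R else (1 - al) / N%:R.
have wt0 j : 0 <= wt j by rewrite /wt; case: ifP => _; rewrite divr_ge0// ?subr_ge0// ltW.
pose w (j : J) : {nonneg R} := NngNum (wt0 j).
have sumw (F : J -> R) : \sum_j (w j)%:num * F j =
    N%:R^-1 * \sum_i (al * F (true, i) + (1 - al) * F (false, i)).
  transitivity (\sum_b \sum_i (w (b, i))%:num * F (b, i)).
    by rewrite pair_bigA; apply: eq_bigr => -[].
  rewrite big_bool/= -big_split/= mulr_sumr; apply: eq_bigr => i _.
  by rewrite /wt/=; field.
have w1 : \sum_j (w j)%:num = 1.
  transitivity (\sum_j (w j)%:num * 1); first by apply: eq_bigr => j _; rewrite mulr1.
  rewrite (sumw (fun=> 1)).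
  under eq_bigr do rewrite !mulr1 addrC subrK.
  by rewrite sumr_const card_ord mulVf.
pose sh : 'cV[R]_n := (rho / al * (s / norm2 x)) *: x.
pose z (j : J) : 'cV[R]_n := if j.1 then xi j.2 + sh else xi j.2.
pose Q : probability E R := dirac_sum_prob (z : J -> E) w1.
pose pi : probability (E * E)%type R :=
  dirac_sum_prob ((fun j => (z j, xi j.2)) : J -> (E * E)%type) w1.
have cpi : coupling Q (empirical xi) pi.
  move=> A mA; split.
    rewrite [LHS]dirac_sumE [RHS]dirac_sumE; apply: eq_bigr => j _.
    congr (_ * _)%E; rewrite !diracE; congr (((nat_of_bool _)%:R)%:E).
    by apply/idP/idP; rewrite !inE => //= -[].
  rewrite [LHS]dirac_sumE.
  transitivity (\sum_j ((w j)%:num * (\1_A (xi j.2) : R))%:E)%E.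
    apply: eq_bigr => j _; rewrite EFinM; congr (_ * _)%E.
    rewrite diracE indicE; congr (((nat_of_bool _)%:R)%:E).
    by apply/idP/idP; rewrite !inE => //= -[].
  rewrite sumEFin (sumw (fun j => \1_A (xi j.2))) /= /empirical EFinM.
  congr (_ * _)%E; rewrite -sumEFin; apply: eq_bigr => i _.
  by rewrite -mulrDl addrC subrK mul1r.
have nsh : norm2 sh <= rho / al.
  rewrite norm2Z normrM [`|s / _|]normrM normfV s1 (ger0_norm (norm2_ge0 x)).
  have ra0 : 0 <= rho / al by rewrite divr_ge0// ltW.
  rewrite (ger0_norm ra0) -mulrA mul1r ler_piMr//.
  have [->|x0] := eqVneq (norm2 x) 0; first by rewrite mulr0.
  by rewrite mulVf.
have Qrho : wball rho Q.
  apply: ge_ereal_inf; exists (transport_cost pi); first by exists pi.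
  rewrite /transport_cost ge0_integral_dirac_sum//; first last.
  - by move=> p; exact: norm2_ge0.
  - exact: measurable_norm2B.
  rewrite lee_fin sumw/= /z/=.
  under eq_bigr do rewrite subrr norm20 mulr0 addr0 addrAC subrr add0r.
  rewrite sumr_const card_ord -[X in _ * X]mulr_natl mulrA mulVf// mul1r.
  by rewrite mulrC -ler_pdivlMr.
rewrite -leeBlDr//; apply: le_ereal_sup_tmp.
exists ('E_Q[loss x])%E; first by exists Q.
rewrite unlock ge0_integral_dirac_sum//; first last.
- by move=> p; exact: L_ge0.
- exact: measurable_loss.
rewrite -EFinB lee_fin sumw/= /z/=.
rewrite big_split/= -!mulr_sumr.
set S0 := \sum_i loss x (xi i).
set S1 := \sum_i loss x (xi i + sh).
have innsh i : inner (xi i + sh) x = inner (xi i) x + rho / al * s * norm2 x.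
  rewrite !inner_linE; congr (_ + _); rewrite -norm2_sqr.
  have [->|x0] := eqVneq (norm2 x) 0; first by rewrite expr0n !mulr0.
  by field; rewrite x0 gt_eqF.
have empE : emp_loss x = N%:R^-1 * S0 by [].
rewrite mulrDr !(mulrCA N%:R^-1) -empE.
have [rx0|rx0] := eqVneq (rho * norm2 x) 0.
  have S10 : S1 = S0.
    apply: eq_bigr => i _; rewrite /loss innsh.
    rewrite (_ : _ * s * _ = rho * norm2 x / al * s); last by ring.
    by rewrite rx0 !mul0r addr0.
  by rewrite S10 -empE -mulrA [norm2 x * _]mulrC rx0 mulr0; lra.
have nE : nrho = rho * norm2 x by rewrite /nrho (negbTE rx0).
have : S1 >= \sum_i (C + m * (s * inner (xi i) x + nrho / al)).
  apply: ler_sum => i _.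
  have ss : s * s = 1.
    by rewrite -expr2 -(ger0_norm (sqr_ge0 s)) normrX s1 expr1n.
  have sE : s * inner (xi i + sh) x = s * inner (xi i) x + nrho / al.
    rewrite innsh mulrDr nE; congr (_ + _).
    rewrite (_ : s * _ = s * s * (rho * norm2 x / al)); last by ring.
    by rewrite ss mul1r.
  rewrite -sE; apply: hL; rewrite sE.
  have : G <= nrho / al by rewrite ler_pdivlMr// mulrC.
  have : `|inner (xi i) x| <= \sum_j `|inner (xi j) x|.
    by rewrite (bigD1 i)//= lerDl sumr_ge0.
  have : - `|inner (xi i) x| <= s * inner (xi i) x.
    by rewrite lerNl; apply: le_trans (ler_norm _) _; rewrite normrN normrM s1 mul1r.
  have := ler_norm B; rewrite /G; lra.
rewrite big_split/= sumr_const card_ord -mulr_sumr big_split/= sumr_const card_ord.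
rewrite -!mulr_sumr -[C *+ N]mulr_natl -[(_ / al) *+ N]mulr_natl.
set S2 := \sum_i inner (xi i) x => hS1.
have {}hS1 : N%:R^-1 * S1 >= C + m * s * (N%:R^-1 * S2) + m * (nrho / al).
  rewrite -(ler_pM2l N0) [leRHS]mulrA divff// mul1r.
  apply: le_trans hS1; rewrite le_eqVlt; apply/orP; left; apply/eqP.
  by field; rewrite gt_eqF.
have : al * (C + m * s * (N%:R^-1 * S2) + m * (nrho / al)) <= al * (N%:R^-1 * S1).
  by rewrite ler_pM2l.
rewrite mulrDr [al * (m * _)]mulrCA [al * (_ / al)]mulrCA divff ?gt_eqF// mulr1.
have : al * (emp_loss x - C - m * s * (N%:R^-1 * S2)) <= e.
  apply: le_trans ale; rewrite ler_pM2l// /D -/S2.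
  by apply: le_trans (ler_norm _) _; rewrite lerDl.
rewrite nE; lra.
Qed.

End Duality.

(** * The upper bound *)

Lemma lipschitz_setTE (R : realType) (L : R -> R) :
  [lipschitz (L : R^o -> R^o) z | z in setT] ->
  exists K : R, forall x y, `|L x - L y| <= K * `|x - y|.
Proof.
move=> /pinfty_ex_gt0[K _ hK]; exists K => x y.
exact: (hK (x, y) (conj Logic.I Logic.I)).
Qed.

Lemma derivable_comp_scale (R : realType) (L : R -> R) (z t : R) :
  derivable (L : R^o -> R^o) (t * z) 1 ->
  derivable ((fun u => L (u * z)) : R^o -> R^o) t 1.
Proof.
move=> /derivable1_diffP dL; apply/derivable1_diffP.
by apply: (@differentiable_comp _ _ _ _ (fun u : R^o => u * z : R^o) L).
Qed.

(* Only left derivatives of [f] at its minimiser [1] are known, so that the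
   derivability of [f] is what prevents [G] from being negative. *)
Lemma derivable_min_left (R : realType) (f : R -> R) (G a : R) :
  derivable (f : R^o -> R^o) 1 1 -> (forall t, f 1 <= f t) ->
  (forall h, -1 <= h <= 0 -> f (1 + h) = f 1 + h * G + h ^+ 2 * a) -> 0 <= G.
Proof.
move=> /cvg_ex[/= D cD] fmin fleft; rewrite leNgt; apply/negP => G0.
(* At the derivative [D], right quotients give [D > - e] by minimality, while left quotients give
   [D < G + 2 e = - 2 e]. *)
pose e : R := - G / 4; have e0 : 0 < e by rewrite /e; lra.
have eE : e = - G / 4 by [].
clearbody e.
move/cvgrPdist_lt : cD => /(_ e e0).
case=> /= d d0 hd.
have q h : h != 0 -> `|h| < d -> `|D - h^-1 * (f (1 + h) - f 1)| < e.
  move=> h0 hlt; have := hd h; rewrite /= sub0r normrN => /(_ hlt h0).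
  by rewrite /GRing.scale/= mulr1 [h + 1]addrC.
pose k := Num.min 1 (Num.min (d / 2) (e / (1 + `|a|))).
have a1 : 0 < 1 + `|a| by rewrite ltr_pwDl.
have k0 : 0 < k by rewrite !lt_min ltr01/= !divr_gt0.
have k1 : k <= 1 by rewrite ge_min lexx.
have kd : k < d.
  have : k <= d / 2 by rewrite !ge_min lexx orbT.
  by lra.
have ka : k * (1 + `|a|) <= e.
  by rewrite -ler_pdivlMr// !ge_min lexx !orbT.
have Dlo : - e < D.
  have := q k; rewrite gt_eqF// gtr0_norm// => /(_ isT kd).
  have : 0 <= k^-1 * (f (1 + k) - f 1) by rewrite mulr_ge0 ?invr_ge0 ?subr_ge0// ltW.
  by move=> ?; rewrite ltr_norml => /andP[? ?]; lra.
have := q (- k); rewrite oppr_eq0 gt_eqF// normrN gtr0_norm// => /(_ isT kd).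
rewrite fleft; last by lra.
rewrite (_ : (- k)^-1 * _ = G - k * a); last by field; rewrite gt_eqF.
have : - (k * a) <= e.
  apply: le_trans ka; rewrite -mulrN ler_pM2l//.
  by have := ler_norm (- a); rewrite normrN; lra.
by move=> ?; rewrite ltr_norml => /andP[? ?]; lra.
Qed.

(** * Closed form of the worst case and the local quadratic model *)

Section SettingTheory.
Variables (R : realType) (I : instance R).
Local Notation n := (Defs.dim I).
Local Notation N := (nsamples I).
Local Notation xi := (@sample R I).
Local Notation L := (lossfun I).
Local Notation x0 := (nominal_sol I).
Local Notation H := (second_moment I).
Local Notation M := (max_slope L).
Hypothesis qI : quadratic_setting I.

Lemma setting_slope_lip (u v : R) : `|L u - L v| <= M * `|u - v|.
Proof.
have [K LK] := lipschitz_setTE (loss_lipschitz qI); exact: max_slope_lip LK u v.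
Qed.

Lemma setting_slope_ge0 : 0 <= M.
Proof.
have [K LK] := lipschitz_setTE (loss_lipschitz qI); exact: max_slope_ge0 LK.
Qed.

Lemma setting_measurable : measurable_fun setT L.
Proof.
apply: continuous_measurable_fun => z.
apply: (@differentiable_continuous _ R^o R^o).
by apply/derivable1_diffP; exact: loss_derivable.
Qed.

Lemma frhoE (rho : R) (x : 'cV[R]_n) : 0 <= rho ->
  frho rho x = (emp_loss x + M * norm2 x * rho)%:E.
Proof.
move=> rho0; apply/eqP; rewrite eq_le; apply/andP; split.
  apply: ge_ereal_sup => _ [Q Qrho <-].
  apply: expectation_wball_le => //.
  - exact: nsamples_gt0 qI.
  - exact: loss_ge0 qI.
  - exact: setting_slope_lip.
  - exact: setting_measurable.
apply/lee_addgt0Pr => e e0.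
have nr0 : 0 <= norm2 x * rho by rewrite mulr_ge0 ?norm2_ge0.
pose m := M - e / (norm2 x * rho + 1).
have mM : m < M by rewrite /m ltrBlDr ltrDl divr_gt0// ltr_wpDl.
have := @frho_ge _ I (nsamples_gt0 qI) (loss_ge0 qI) (loss_convex qI) M
  setting_slope_lip setting_measurable rho x m rho0 mM.
rewrite -leeBlDr// => /(le_trans _); apply.
rewrite -EFinB lee_fin /m -!mulrA mulrBl.
have : e / (norm2 x * rho + 1) * (norm2 x * rho) <= e.
  rewrite -mulrA ler_piMr ?(ltW e0)// mulrC ler_pdivrMr ?ltr_wpDl//; lra.
lra.
Qed.

(** The worst loss at 0 is [L 0]. A nonzero robust solution has inner products covering the whole
    line, so [L <= L 0] everywhere, against the growth of [L] at infinity. *)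
Lemma slope_gt0_robust_eq0 : 0 < M -> robust_sol I = 0.
Proof.
move=> M0; apply/eqP; apply/negP => /negP r0.
have [K LK] := lipschitz_setTE (loss_lipschitz qI).
have Lub v : L v <= L 0.
  have := robust_sol_min qI 0.
  have -> : @worst_loss R I 0 = (L 0)%:E.
    rewrite /worst_loss; apply/eqP; rewrite eq_le; apply/andP; split.
      by apply: ge_ereal_sup => _ [z _ <-]; rewrite /loss inner0r.
    by apply: ereal_sup_ubound; exists 0 => //; rewrite /loss inner0r.
  rewrite -lee_fin; apply: le_trans.
  apply: ereal_sup_ubound; exists ((v / inner (robust_sol I) (robust_sol I)) *: robust_sol I) => //.
  by rewrite /loss innerZl divfK// inner_eq0.
have mM : M / 2 < M by lra.
have [s [C [B [s1 hL]]]] := asymptotic_slope (loss_convex qI) LK mM.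
pose t := Num.max B ((L 0 - C) / (M / 2) + 1).
have ss : s * (s * t) = t.
  by rewrite mulrA -expr2 -(ger0_norm (sqr_ge0 s)) normrX s1 expr1n mul1r.
have := hL (s * t); rewrite ss le_max lexx => /(_ isT).
apply/negP; rewrite -ltNge; apply: le_lt_trans (Lub _) _.
rewrite -ltrBlDl mulrC -ltr_pdivrMr ?divr_gt0// lt_max.
by apply/orP; right; rewrite ltrDl.
Qed.

Let N0 : 0 < N%:R :> R. Proof. by rewrite ltr0n (nsamples_gt0 qI). Qed.
Let Nn0 : N%:R != 0 :> R. Proof. by rewrite gt_eqF. Qed.

Lemma inner_second_moment (u v : 'cV[R]_n) :
  inner u (H *m v) = N%:R^-1 * \sum_i inner u (xi i) * inner (xi i) v.
Proof.
rewrite /second_moment -scalemxAl innerZr mulmx_suml; congr (_ * _).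
rewrite /inner mulmx_sumr summxE; apply: eq_bigr => i _.
by rewrite -[_ *m _ *m v]mulmxA mulmxA mxE big_ord1.
Qed.

Definition sample_mean : 'cV[R]_n := N%:R^-1 *: \sum_i xi i.

Lemma inner_sample_mean (u : 'cV[R]_n) :
  inner sample_mean u = N%:R^-1 * \sum_i inner (xi i) u.
Proof.
rewrite /sample_mean innerZl /inner linear_sum mulmx_suml summxE; congr (_ * _).
Qed.

(** On this ball all the inner products lie in [Zset]; [g] is the gradient at [x0] of the resulting
    quadratic. As [x0] is on the boundary of the ball, only signs of [inner g] are extracted
    next. *)
Lemma ball_expansion : exists g : 'cV[R]_n, forall x, norm2 x <= norm2 x0 ->
  emp_loss x = emp_loss x0 + inner g (x - x0) + inner (x - x0) (H *m (x - x0)).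
Proof.
have [b [c Lq]] := loss_quadratic qI.
have sH := (second_moment_posdef qI).1.
have q x : norm2 x <= norm2 x0 ->
    emp_loss x = inner x (H *m x) + b * inner sample_mean x + c.
  move=> hx; rewrite inner_second_moment inner_sample_mean.
  transitivity (N%:R^-1 * \sum_i (inner x (xi i) * inner (xi i) x +
      b * inner (xi i) x + c)).
    congr (_ * _); apply: eq_bigr => i _; rewrite /loss (innerC x) Lq.
      by rewrite expr2.
    by exists x, i; split => //; rewrite innerC.
  rewrite !big_split/= sumr_const card_ord -mulr_sumr !mulrDr -[c *+ N]mulr_natl.
  by rewrite mulKf// (mulrCA N%:R^-1 b).
exists (2 *: (H *m x0) + b *: sample_mean) => x hx.
rewrite (q x hx) (q x0 (lexx _)) mulmxBr !inner_linE.
rewrite ![inner (H *m x0) _]innerC.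
by rewrite [inner x0 (H *m x)]inner_mulmxA// [inner (H *m x0) x]innerC; ring.
Qed.

Lemma derivable_path : derivable ((fun t => emp_loss (t *: x0)) : R^o -> R^o) 1 1.
Proof.
rewrite (_ : (fun _ => _) =
    N%:R^-1 \*: (\sum_(i < N) (fun t => L (t * inner (xi i) x0) : R^o))).
  apply: derivableZ; apply: derivable_sum => i.
  by apply: derivable_comp_scale; exact: loss_derivable.
apply/funext => t; rewrite /emp_loss fct_sumE; congr (_ * _).
by apply: eq_bigr => i _; rewrite /loss innerZr.
Qed.

(** The linear term is [(s - 1) * inner g x0], and [derivable_min_left] gives [0 <= inner g x0]. *)
Lemma path_loss_le (s : R) : 0 <= s <= 1 ->
  emp_loss (s *: x0) <= emp_loss x0 + (1 - s) ^+ 2 * inner x0 (H *m x0).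
Proof.
have [g gE] := ball_expansion.
have path h : -1 <= h <= 0 -> emp_loss ((1 + h) *: x0) =
    emp_loss x0 + h * inner g x0 + h ^+ 2 * inner x0 (H *m x0).
  move=> /andP[h1 h0]; rewrite gE.
    rewrite (_ : (1 + h) *: x0 - x0 = h *: x0).
      by rewrite -scalemxAr !inner_linE; ring.
    by rewrite scalerDl scale1r addrAC subrr add0r.
  by rewrite norm2Z ler_piMl ?norm2_ge0// ger0_norm; lra.
have g0 : 0 <= inner g x0.
  apply: (derivable_min_left derivable_path) => [t|h hh].
    by rewrite scale1r; exact: (nominal_sol_min qI).
  by rewrite path// scale1r.
move=> /andP[s0 s1].
have -> : s = 1 + (s - 1) by ring.
rewrite path; last by apply/andP; split; lra.
have : (s - 1) * inner g x0 <= 0 by rewrite mulr_le0_ge0//; lra.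
lra.
Qed.

(** The segment from [x0] to [x] stays in the ball; were [inner g (x - x0)] negative, a short step
    along it would beat [x0]. *)
Lemma ball_loss_ge (x : 'cV[R]_n) : norm2 x <= norm2 x0 ->
  emp_loss x0 + inner (x - x0) (H *m (x - x0)) <= emp_loss x.
Proof.
move=> hx; have [g gE] := ball_expansion.
rewrite (gE x hx).
have : x = x0 + (x - x0) by rewrite addrC subrK.
set v := x - x0; clearbody v => xE; set b := inner v (H *m v).
suff : 0 <= inner g v by lra.
rewrite leNgt; apply/negP => gv0.
pose t := Num.min 1 (- inner g v / (1 + `|b|)).
have b1 : 0 < 1 + `|b| by rewrite ltr_pwDl.
have t0 : 0 < t by rewrite lt_min ltr01/= divr_gt0// oppr_gt0.
have t1 : t <= 1 by rewrite ge_min lexx.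
have tb : t * (1 + `|b|) <= - inner g v.
  by rewrite -ler_pdivlMr// ge_min lexx orbT.
have : emp_loss x0 <= emp_loss (x0 + t *: v) by exact: (nominal_sol_min qI).
rewrite (gE (x0 + t *: v)).
  rewrite [x0 + _]addrC [_ + x0 - x0]addrK -scalemxAr !inner_linE -/b.
  have tbb : t * (t * b) <= t * (t * `|b|).
    by rewrite !ler_pM2l// ler_norm.
  have : t * (t * (1 + `|b|)) <= t * (- inner g v) by rewrite ler_pM2l.
  have : 0 < t * t by rewrite mulr_gt0.
  lra.
rewrite (_ : x0 + _ = (1 - t) *: x0 + t *: x); last first.
  by rewrite xE scalerDr scalerBl scale1r addrA subrK.
apply: le_trans (norm2_triangle _ _) _; rewrite !norm2Z.
rewrite ger0_norm ?subr_ge0// (ger0_norm (ltW t0)).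
have : t * norm2 x <= t * norm2 x0 by rewrite ler_pM2l.
lra.
Qed.

End SettingTheory.

Lemma goldenE (R : realType) : golden R ^+ 2 = golden R + 1.
Proof.
have s5 : Num.sqrt 5 ^+ 2 = 5 :> R by rewrite sqr_sqrtr.
by rewrite /golden expr_div_n sqrrD s5; field.
Qed.

Lemma golden_ge0 (R : realType) : 0 <= golden R.
Proof. by rewrite divr_ge0// addr_ge0// sqrtr_ge0. Qed.

(* [s = 1 - eta tau / a] minimises the left-hand side, and the right-hand side is
   the value at the worst [tau]. *)
Lemma shrinkage_choice (R : realFieldType) (a eta tau : R) :
  0 < a -> 0 < eta -> 0 <= tau -> exists2 s, 0 <= s <= 1 &
    a * (1 - s) ^+ 2 + 2 * eta * tau * s <= a * eta / (a + eta) + eta * tau ^+ 2.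
Proof.
move=> a0 e0 t0; have ae0 : 0 < a + eta by rewrite addr_gt0.
have [h|h] := leP (eta * tau) a.
  exists (1 - eta * tau / a).
    rewrite subr_ge0 gerBl ler_pdivrMr// mul1r h divr_ge0// ?mulr_ge0// ltW//.
  rewrite -subr_ge0 (_ : _ - _ =
    eta * (a - tau * (a + eta)) ^+ 2 / (a * (a + eta))).
    by apply: divr_ge0; [rewrite mulr_ge0 ?sqr_ge0 ?ltW|rewrite ltW ?mulr_gt0].
  by field; rewrite !gt_eqF.
(* The unconstrained minimiser is negative here, so the path is used at its robust end. *)
exists 0; first by rewrite lexx ler01.
rewrite subr0 expr1n mulr1 mulr0 addr0 -subr_ge0.
rewrite (_ : _ - _ = (eta * (eta * tau ^+ 2) * (a + eta) - a ^+ 2 * eta) / (eta * (a + eta))).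
  apply: divr_ge0; last by rewrite ltW// mulr_gt0.
  rewrite subr_ge0 mulrDr.
  have : a ^+ 2 * eta <= eta * tau * (eta * tau) * eta.
    by rewrite ler_pM2r// expr2 ler_pM// ltW.
  have : 0 <= eta * (eta * tau ^+ 2) * a by rewrite !mulr_ge0 ?(ltW e0) ?(ltW a0).
  lra.
by field; rewrite !gt_eqF.
Qed.

(** * Suboptimality of the shrinkage path *)

Section UpperBound.
Variables (R : realType) (I : instance R).
Local Notation n := (Defs.dim I).
Local Notation L := (lossfun I).
Local Notation x0 := (nominal_sol I).
Local Notation H := (second_moment I).
Local Notation M := (max_slope L).
Local Notation l := (lmin I).
Local Notation u := (lmax I).
Local Notation phi := (golden R).
Hypothesis qI : quadratic_setting I.

Let sH : H^T = H. Proof. exact: (second_moment_posdef qI).1. Qed.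

Lemma lmin_gt0 : 0 < l.
Proof.
have [/(eigenvalueP_cV _ sH)[v vH v0] _] := lmin_eigen qI.
have := (second_moment_posdef qI).2 v v0.
by rewrite vH innerZr pmulr_lgt0// inner_gt0.
Qed.

Lemma lmin_le_lmax : l <= u.
Proof.
by have [_] := lmin_eigen qI; apply; have [] := lmax_eigen qI.
Qed.

(** Cleared of the condition number, the bound takes the form delivered by [chord_gap]. *)
Lemma boundE : bound I =
  norm2 x0 ^+ 2 * ((u - l) ^+ 2 / (phi ^+ 5 * (u - l) + 27 * l)).
Proof.
have l0 := lmin_gt0; have lu := lmin_le_lmax; have p0 := golden_ge0 R.
have p5 : 0 <= phi ^+ 5 by rewrite exprn_ge0.
have d0 : 0 < phi ^+ 5 * (u - l) + 27 * l by rewrite ltr_wpDl ?mulr_ge0//; lra.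
rewrite /bound /cond; field; apply/and3P; split; rewrite gt_eqF//; lra.
Qed.

Lemma bound_ge0 : 0 <= bound I.
Proof.
have l0 := lmin_gt0; have lu := lmin_le_lmax; have p0 := golden_ge0 R.
have p5 : 0 <= phi ^+ 5 by rewrite exprn_ge0.
rewrite boundE mulr_ge0 ?sqr_ge0// divr_ge0 ?sqr_ge0// addr_ge0 ?mulr_ge0//; lra.
Qed.

(** With [gam = M * rho], each competitor [x] is matched by its own point of the path. Outside the
    ball [x0] already wins; inside, both sides are compared through ridge regression. *)
Lemma path_suboptimality (gam : R) (x : 'cV[R]_n) : 0 <= gam ->
  exists2 s, 0 <= s <= 1 &
    emp_loss (s *: x0) + gam * norm2 (s *: x0) <=
    emp_loss x + gam * norm2 x + bound I.
Proof.
move=> gam0; have b0 := bound_ge0.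
have fx0 : emp_loss x0 <= emp_loss x by exact: (nominal_sol_min qI).
have [xb|xb] := leP (norm2 x) (norm2 x0); last first.
  exists 1; rewrite ?ler01 ?lexx// scale1r.
  have : gam * norm2 x0 <= gam * norm2 x by rewrite ler_wpM2l// ltW.
  lra.
have [g0|g0] := eqVneq gam 0.
  by exists 1; rewrite ?ler01 ?lexx// scale1r g0; lra.
have [->|xn0] := eqVneq x 0.
  by exists 0; rewrite ?ler01 ?lexx// scale0r; lra.
have gam_gt0 : 0 < gam by rewrite lt_def g0.
have nx0 : 0 < norm2 x by rewrite norm2_gt0.
have r0 : 0 < norm2 x0 by exact: lt_le_trans xb.
have X0 : 0 < norm2 x0 ^+ 2 by rewrite exprn_gt0.
(* This ridge parameter depends on [x] so that [gam * norm2 x = 2 eta |x|^2]; [tau] is the relative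
   length of [x], and [a] the Rayleigh quotient at [x0]. *)
pose eta := gam / (2 * norm2 x).
have eta0 : 0 < eta by rewrite divr_gt0// mulr_gt0.
pose tau := norm2 x / norm2 x0.
have tau0 : 0 <= tau by rewrite divr_ge0// ltW.
pose a := inner x0 (H *m x0) / norm2 x0 ^+ 2.
have a0 : 0 < a.
  by rewrite divr_gt0//; apply: (second_moment_posdef qI).2; rewrite -norm2_gt0.
have [s s01 hs] := shrinkage_choice a0 eta0 tau0.
exists s => //; apply: le_trans (lerD (path_loss_le qI s01) (lexx _)) _.
have hH w : l * inner w w <= inner w (H *m w) <= u * inner w w.
  by rewrite rayleigh_min ?rayleigh_max//; [exact: lmax_eigen|exact: lmin_eigen].
have := quadform_chord x0 x sH lmin_gt0 lmin_le_lmax eta0 hH.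
have := ball_loss_ge qI xb.
have := chord_gap (goldenE R) (golden_ge0 R) lmin_gt0 lmin_le_lmax a0 eta0.
rewrite norm2Z ger0_norm; last by case/andP: s01.
rewrite boundE -!norm2_sqr.
have aE : inner x0 (H *m x0) = a * norm2 x0 ^+ 2 by rewrite /a divfK// gt_eqF.
have gE : gam * norm2 x = 2 * (eta * norm2 x ^+ 2).
  by rewrite /eta; field; rewrite gt_eqF.
have gE' : gam * (s * norm2 x0) = 2 * eta * tau * s * norm2 x0 ^+ 2.
  by rewrite /eta /tau; field; rewrite !gt_eqF.
have tE : eta * norm2 x ^+ 2 = eta * tau ^+ 2 * norm2 x0 ^+ 2.
  by rewrite /tau; field; rewrite gt_eqF.
rewrite gE gE' aE tE.
set c := (u - l) ^+ 2 / _; set k := eta ^+ 2 / ((l + eta) * (u + eta)).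
set q := inner (x - x0) _.
have -> : eta ^+ 2 * (l + u - a + eta) / ((l + eta) * (u + eta)) = k * (l + u - a + eta).
  by rewrite /k mulrAC.
move=> h1 h2 h3.
(* The shrinkage value plus [chord_gap], per unit of [|x0|^2]; scaling by [|x0|^2] brings in
   [quadform_chord] and [ball_loss_ge]. *)
have h4 : a * (1 - s) ^+ 2 + 2 * eta * tau * s <=
    c + (eta - k * (l + u - a + eta)) + eta * tau ^+ 2 by lra.
have := h4; rewrite -(ler_pM2r X0) => h5.
lra.
Qed.

Lemma fstar_fin_num rho : 0 <= rho -> fstar I rho \is a fin_num.
Proof.
move=> rho0; apply/fin_real/andP; split.
  apply: (@lt_le_trans _ _ 0%E) => //; apply: le_ereal_inf_tmp => _ [x _ <-].
  rewrite frhoE// lee_fin; apply: addr_ge0.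
    rewrite mulr_ge0 ?invr_ge0// sumr_ge0// => i _; exact: (loss_ge0 qI).
  by rewrite !mulr_ge0 ?norm2_ge0 ?setting_slope_ge0.
apply: (@le_lt_trans _ _ (frho rho x0)); last by rewrite frhoE// ltry.
by apply: ereal_inf_lbound; exists x0.
Qed.

Lemma fhat_le_path rho s : 0 <= rho -> 0 <= s <= 1 -> 0 < M ->
  (fhat I rho <= (emp_loss (s *: x0) + M * norm2 (s *: x0) * rho)%:E)%E.
Proof.
move=> rho0 s01 M0; apply: ge_ereal_inf; exists (frho rho (shrink_path I (1 - s))).
  by exists (1 - s) => //; rewrite /= in_itv/=; have /andP[s0 s1] := s01; apply/andP; split; lra.
by rewrite frhoE// /shrink_path (slope_gt0_robust_eq0 qI M0) scaler0 addr0 subKr.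
Qed.

Lemma subopt_le_bound : (subopt I <= (bound I)%:E)%E.
Proof.
apply: ge_ereal_sup => _ [rho /= rho0 <-].
rewrite leeBlDr ?fstar_fin_num//.
rewrite -leeBlDl//; apply: le_ereal_inf_tmp => _ [x _ <-]; rewrite leeBlDl//.
rewrite frhoE// -EFinD.
have [M0|M0] := ltP 0 M.
  have gam0 : 0 <= M * rho by rewrite mulr_ge0// ltW.
  have [s s01 hs] := path_suboptimality x gam0.
  apply: le_trans (fhat_le_path rho0 s01 M0) _; rewrite lee_fin.
  by move: hs; rewrite ![M * rho * _]mulrAC; lra.
(* Here [L] is constant and the robust solution arbitrary, so the path is evaluated at its nominal
   end. *)
have M00 : M = 0 by apply/eqP; rewrite eq_le M0 (setting_slope_ge0 qI).
apply: (@le_trans _ _ (frho rho (shrink_path I 0))).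
  by apply: ereal_inf_lbound; exists 0 => //; rewrite /= in_itv/= lexx ler01.
rewrite frhoE// lee_fin M00 !mul0r !addr0.
have -> : emp_loss (shrink_path I 0) = emp_loss x.
  congr (_ * _); apply: eq_bigr => i _; apply/eqP.
  rewrite -subr_eq0 -normr_le0; apply: le_trans (setting_slope_lip qI _ _) _.
  by rewrite M00 mul0r.
by rewrite lerDr bound_ge0.
Qed.

End UpperBound.

(** * Tight instances *)

Section Huber.
Variables (R : realType) (T : R).
Hypothesis T0 : 0 < T.

Definition clamp (u : R) : R := Num.max (- T) (Num.min u T).

(** Twice the usual Huber function: [u^2] on [[-T, T]] and [2 T |u| - T^2] outside. *)
Definition huber (u : R) : R := 2 * clamp u * u - clamp u ^+ 2.

Lemma clamp_itv u : - T <= clamp u <= T.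
Proof.
have TT : - T <= T by move: T0; lra.
by rewrite le_max lexx/= ge_max ge_min lexx orbT andbT.
Qed.

Lemma clamp_id u : - T <= u <= T -> clamp u = u.
Proof. by move=> /andP[Tu uT]; rewrite /clamp min_l// max_r. Qed.

Lemma huber_id u : - T <= u <= T -> huber u = u ^+ 2.
Proof. by move=> uT; rewrite /huber clamp_id//; ring. Qed.

(** The variational inequality of the projection onto [[-T, T]]. *)
Lemma clamp_proj u w : - T <= w <= T -> (u - clamp u) * (w - clamp u) <= 0.
Proof.
have T1 := T0; move=> /andP[Tw wT]; have [uT|Tu] := leP u T; last first.
  have -> : clamp u = T by rewrite /clamp min_r ?max_r// ?ltW//; lra.
  by apply: mulr_ge0_le0; lra.
have [Tu|uT'] := leP (- T) u; first by rewrite clamp_id ?Tu// subrr mul0r.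
have -> : clamp u = - T by rewrite /clamp min_l// max_l// ltW.
by apply: mulr_le0_ge0; lra.
Qed.

(* [huber] is a supremum of affine functions, attained at [w = clamp u]; this
   gives its convexity, its Lipschitz bound and its derivative at once. *)
Lemma huber_affine_le u w : - T <= w <= T -> 2 * w * u - w ^+ 2 <= huber u.
Proof.
move=> wT; have := clamp_proj u wT.
have := sqr_ge0 (w - clamp u); rewrite /huber; lra.
Qed.

Lemma huber_ge0 u : 0 <= huber u.
Proof.
have T1 := T0; have : - T <= 0 <= T by apply/andP; split; lra.
by move=> /(huber_affine_le u); rewrite mulr0 mul0r expr0n subr0.
Qed.

Lemma huber_tangent u v : huber u + 2 * clamp u * (v - u) <= huber v.
Proof. by have := huber_affine_le v (clamp_itv u); rewrite /huber; lra. Qed.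

(** Adding the two projection inequalities shows that the square of the increment of [clamp] is at
    most its product with [v - u]. *)
Lemma clamp_monotone u v : u <= v -> 0 <= clamp v - clamp u <= v - u.
Proof.
move=> uv; have := clamp_proj u (clamp_itv v); have := clamp_proj v (clamp_itv u).
move=> h1 h2.
have h : (clamp v - clamp u) ^+ 2 <= (v - u) * (clamp v - clamp u) by lra.
have h0 : 0 <= clamp v - clamp u.
  rewrite leNgt; apply/negP => h0.
  have : (v - u) * (clamp v - clamp u) <= 0.
    by apply: mulr_ge0_le0; lra.
  have : 0 < (clamp v - clamp u) ^+ 2 by rewrite expr2 nmulr_rgt0.
  lra.
rewrite h0/= leNgt; apply/negP => h3.
have h4 : 0 < clamp v - clamp u by lra.
by move: h; rewrite expr2 ler_pM2r// leNgt h3.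
Qed.

Lemma huber_expand u v :
  0 <= huber v - huber u - 2 * clamp u * (v - u) <= 2 * (v - u) ^+ 2.
Proof.
have h1 := huber_tangent u v; have h2 := huber_tangent v u.
apply/andP; split; first lra.
apply: (@le_trans _ _ (2 * ((clamp v - clamp u) * (v - u)))); first lra.
rewrite ler_pM2l//; have [uv|/ltW vu] := leP u v.
  have /andP[_] := clamp_monotone uv.
  by rewrite expr2 => h; rewrite ler_wpM2r ?subr_ge0.
have /andP[_ h] := clamp_monotone vu.
rewrite -mulrNN -sqrrN expr2 ler_wpM2r//; lra.
Qed.

Lemma huber_lip u v : `|huber u - huber v| <= 2 * T * `|u - v|.
Proof.
wlog uv : u v / huber v <= huber u => [hw|].
  have [|/ltW] := leP (huber v) (huber u); first exact: hw.
  by move=> h; rewrite distrC [`|u - v|]distrC; exact: hw.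
rewrite ger0_norm ?subr_ge0//.
apply: (@le_trans _ _ (2 * (clamp u * (u - v)))).
  by have := huber_tangent u v; lra.
rewrite -mulrA ler_pM2l//; apply: le_trans (ler_norm _) _.
by rewrite normrM ler_wpM2r// ler_norml clamp_itv.
Qed.

Lemma huber_convex c :
  convex_function (setT : set R^o) ((fun z => huber (z - c)) : R^o -> R^o).
Proof.
have key (s x y : R) : 0 <= s -> 0 <= 1 - s ->
    huber (s * x + (1 - s) * y - c) <= s * huber (x - c) + (1 - s) * huber (y - c).
  move=> s0 s1; set m := s * x + (1 - s) * y.
  have h1 := ler_wpM2l s0 (huber_tangent (m - c) (x - c)).
  have h2 := ler_wpM2l s1 (huber_tangent (m - c) (y - c)).
  apply: le_trans (lerD h1 h2); rewrite le_eqVlt; apply/orP; left; apply/eqP.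
  by rewrite /m; ring.
move=> t x y _ _.
have t1 : 0 <= 1 - t%:num by rewrite subr_ge0.
exact: (key t%:num x y _ t1).
Qed.

Lemma huber_derivable c (z : R) :
  derivable ((fun z => huber (z - c)) : R^o -> R^o) z 1.
Proof.
apply/cvg_ex; exists (2 * clamp (z - c)); apply/cvgrPdist_lt => e e0.
near=> h.
have h0 : h != 0 by near: h; exact: nbhs_dnbhs_neq.
rewrite /GRing.scale/= mulr1.
have /andP[lo hi] := huber_expand (z - c) (h + z - c).
have hE : h + z - c - (z - c) = h by ring.
move: lo hi; rewrite hE; set d := huber (h + z - c) - _ => lo hi.
rewrite distrC.
have -> : h^-1 * d - 2 * clamp (z - c) = (d - 2 * clamp (z - c) * h) / h by field.
rewrite normrM normfV ltr_pdivrMr ?normr_gt0// ger0_norm//.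
apply: le_lt_trans hi _; rewrite -(ger0_norm (sqr_ge0 h)) normrX expr2 mulrA.
rewrite ltr_pM2r ?normr_gt0//.
have : `|h| < e / 2.
  near: h; apply: dnbhs0_lt; by rewrite divr_gt0.
lra.
Unshelve. all: by end_near.
Qed.

End Huber.

(** * Vectors of the plane *)

Section Plane.
Variable R : realType.

Definition vec2 (a b : R) : 'cV[R]_2 := \col_i (if i == 0 then a else b).

Lemma vec2_0 a b : vec2 a b 0 0 = a. Proof. by rewrite mxE. Qed.
Lemma vec2_1 a b : vec2 a b 1 0 = b. Proof. by rewrite mxE. Qed.

Lemma big_ord2 (F : 'I_2 -> R) : \sum_i F i = F 0 + F 1.
Proof.
rewrite big_ord_recl big_ord1; congr (_ + F _); exact: val_inj.
Qed.

Lemma vec2_eta (v : 'cV[R]_2) : v = vec2 (v 0 0) (v 1 0).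
Proof.
apply/colP => i; rewrite mxE; case: eqVneq => [->//|].
by case: i => -[|[|//]] //= hi _; congr (v _ _); exact: val_inj.
Qed.

Lemma inner_vec2 a b c d : inner (vec2 a b) (vec2 c d) = a * c + b * d.
Proof. by rewrite innerE big_ord2 !vec2_0 !vec2_1. Qed.

Lemma scale_vec2 k a b : k *: vec2 a b = vec2 (k * a) (k * b).
Proof. by apply/colP => i; rewrite !mxE; case: ifP. Qed.

End Plane.

(** * The two-parameter family of instances *)

Section TightInstance.
Variables (R : realType) (Q dl : R).

Let r : R := Num.sqrt Q.
Let h2 : R := Q ^+ 2 - 1 + dl.
Let sg : R := Num.sqrt (dl * h2).
Let tau : R := (1 + Q) * (Q - 1 + dl).

Definition tight_sol : 'cV[R]_2 := vec2 r 1.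

(** The samples are [(dl r, h2)] plus or minus [sg (-1, r)]: the second vector is orthogonal to
    [tight_sol], and [sg] cancels the off-diagonal second moment. *)
Definition tight_sample (i : 'I_2) : 'cV[R]_2 :=
  if i == 0 then vec2 (dl * r - sg) (h2 + sg * r)
  else vec2 (dl * r + sg) (h2 - sg * r).

(** Large enough, by Cauchy-Schwarz, for the Huber loss to be in its quadratic zone on all of
    [Zset]. *)
Definition tight_range : R :=
  tau + norm2 tight_sol * (norm2 (tight_sample 0) + norm2 (tight_sample 1)).

(* The second moment matrix is [tau * diag (dl, h2)], and every sample is
   interpolated exactly: [inner (tight_sample i) tight_sol = tau]. *)
Definition tight_instance : instance R :=
  @Instance R 2 2 tight_sample (fun z => huber tight_range (z - tau))
    tight_sol 0 (tau * dl) (tau * h2).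

Local Notation I := tight_instance.
Local Notation S := (second_moment I).

Hypothesis Q1 : 1 < Q.
Hypothesis dl01 : 0 < dl < 1.

Let dl0 : 0 < dl. Proof. by case/andP: dl01. Qed.
Let r2 : r ^+ 2 = Q. Proof. by rewrite sqr_sqrtr//; have := Q1; lra. Qed.
Let Q2 : 1 < Q ^+ 2. Proof. by rewrite exprn_egt1. Qed.
Let h20 : 0 < h2. Proof. by have := Q2; have := dl0; rewrite /h2; lra. Qed.
Let sg2 : sg ^+ 2 = dl * h2.
Proof. by rewrite sqr_sqrtr// ltW// mulr_gt0. Qed.
Let tau0 : 0 < tau.
Proof. by have := Q1; have := dl0 => *; rewrite mulr_gt0//; lra. Qed.

Lemma tight_interpolation i : inner (tight_sample i) tight_sol = tau.
Proof.
rewrite /tight_sample /tight_sol /tau; have := r2; rewrite expr2 => rr.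
by case: ifP => _; rewrite inner_vec2 /h2; ring : rr.
Qed.

Lemma tight_second_moment (u v : 'cV[R]_2) :
  inner u (S *m v) = tau * (dl * (u 0 0 * v 0 0) + h2 * (u 1 0 * v 1 0)).
Proof.
rewrite (@inner_second_moment _ I) /= big_ord2 [u]vec2_eta [v]vec2_eta.
rewrite /= /tight_sample/= !inner_vec2 !vec2_0 !vec2_1.
have rr : r * r = Q by rewrite -expr2.
have ss : sg * sg = dl * h2 by rewrite -expr2.
have tE : tau = dl * Q + h2 by rewrite /tau /h2; ring.
rewrite tE; move: (u 0 0) (u 1 0) (v 0 0) (v 1 0) => a b c d.
apply: (canLR (mulKf _)); first by rewrite pnatr_eq0.
ring : rr ss.
Qed.

Lemma tight_mulmx (v : 'cV[R]_2) :
  S *m v = vec2 (tau * dl * v 0 0) (tau * h2 * v 1 0).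
Proof.
rewrite [S *m v]vec2_eta; congr vec2.
  have := tight_second_moment (vec2 1 0) v.
  by rewrite [S *m v]vec2_eta inner_vec2 !vec2_0 !vec2_1 => h; lra.
have := tight_second_moment (vec2 0 1) v.
by rewrite [S *m v]vec2_eta inner_vec2 !vec2_0 !vec2_1 => h; lra.
Qed.

Lemma tight_posdef : posdef S.
Proof.
split.
  rewrite /second_moment linearZ/= linear_sum/=; congr (_ *: _).
  by apply: eq_bigr => i _; rewrite trmx_mul trmxK.
move=> v v0; rewrite tight_second_moment mulr_gt0//.
rewrite -!expr2; have [v00|v00] := eqVneq (v 0 0) 0.
  have v10 : v 1 0 != 0.
    apply: contraNneq v0 => v10; rewrite [v]vec2_eta v00 v10.
    by apply/eqP/colP => i; rewrite !mxE; case: ifP.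
  by rewrite v00 expr0n mulr0 add0r mulr_gt0// lt_def sqr_ge0 sqrf_eq0 v10.
rewrite ltr_pwDl//; first by rewrite mulr_gt0// lt_def sqr_ge0 sqrf_eq0 v00.
by rewrite mulr_ge0 ?sqr_ge0// ltW.
Qed.

Lemma tight_eigenvalue b : eigenvalue S b <-> b = tau * dl \/ b = tau * h2.
Proof.
have sS := tight_posdef.1; split.
  move=> /(eigenvalueP_cV _ sS)[v vS v0].
  have e0 := congr1 (fun w : 'cV_2 => w 0 0) vS.
  have e1 := congr1 (fun w : 'cV_2 => w 1 0) vS.
  rewrite tight_mulmx vec2_0 mxE in e0; rewrite tight_mulmx vec2_1 mxE in e1.
  have [v00|v00] := eqVneq (v 0 0) 0; last by left; apply: esym; exact: mulIf e0.
  right; apply: esym; apply: mulIf e1; apply: contraNneq v0 => v10.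
  by rewrite [v]vec2_eta v00 v10; apply/eqP/colP => i; rewrite !mxE; case: ifP.
move=> h; apply/(eigenvalueP_cV _ sS); case: h => ->.
  exists (vec2 1 0).
    by rewrite tight_mulmx vec2_0 vec2_1 scale_vec2 !mulr0.
  by apply/eqP => /(congr1 (fun w : 'cV_2 => w 0 0))/eqP; rewrite vec2_0 mxE oner_eq0.
exists (vec2 0 1).
  by rewrite tight_mulmx vec2_0 vec2_1 scale_vec2 !mulr0.
by apply/eqP => /(congr1 (fun w : 'cV_2 => w 1 0))/eqP; rewrite vec2_1 mxE oner_eq0.
Qed.

Lemma tight_range_ge : tau <= tight_range.
Proof. by rewrite lerDl mulr_ge0 ?addr_ge0 ?norm2_ge0. Qed.

Let T0 : 0 < tight_range. Proof. exact: lt_le_trans tight_range_ge. Qed.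

Lemma tight_quadratic_range (x : 'cV[R]_2) i : norm2 x <= norm2 tight_sol ->
  - tight_range <= inner (tight_sample i) x - tau <= tight_range.
Proof.
move=> hx; rewrite -ler_norml; apply: le_trans (ler_normB _ _) _.
rewrite (gtr0_norm tau0) addrC lerD2l; apply: le_trans (inner_le_norm2 _ _) _.
rewrite mulrC ler_pM ?norm2_ge0//.
have := norm2_ge0 (tight_sample 0); have := norm2_ge0 (tight_sample 1).
have [->|i0] := eqVneq i 0; first by lra.
have -> : i = 1 by apply: val_inj; case: i i0 => -[|[|//]].
lra.
Qed.

Lemma tight_emp_loss (x : 'cV[R]_2) : norm2 x <= norm2 tight_sol ->
  emp_loss (I := I) x = inner (x - tight_sol) (S *m (x - tight_sol)).
Proof.
move=> hx; rewrite (@inner_second_moment _ I); congr (_ * _); apply: eq_bigr => i _.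
rewrite /loss/= huber_id ?tight_quadratic_range// [inner (x - _) _]innerC -expr2.
by rewrite innerDr innerNr tight_interpolation.
Qed.

Lemma tight_setting : quadratic_setting I.
Proof.
split => //=.
- by move=> z; exact: huber_ge0 T0 _.
- exact: huber_convex T0 _.
- apply: (@klipschitzW _ _ _ (2 * tight_range)).
    exact: (@globally_properfilter _ _ (0, 0)).
  move=> [x y] _ /=; apply: le_trans (huber_lip T0 _ _) _.
  by rewrite (_ : x - tau - (y - tau) = x - y)//; ring.
- by move=> z; exact: huber_derivable T0 _ _.
- move=> y; rewrite tight_emp_loss// subrr mulmx0 inner0r.
  rewrite mulr_ge0 ?invr_ge0// sumr_ge0// => i _; exact: (huber_ge0 T0).
- move=> y; apply: ge_ereal_sup => _ [z _ <-]; rewrite /loss inner0r.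
  by apply: ereal_sup_ubound; exists 0 => //; rewrite /loss inner0l.
- exists (- (2 * tau)), (tau ^+ 2) => z [x [i [hx ->]]].
  rewrite huber_id; first by ring.
  by rewrite innerC; exact: tight_quadratic_range.
- exact: tight_posdef.
- split; first by apply/tight_eigenvalue; left.
  move=> b /tight_eigenvalue[] -> //=; rewrite ler_pM2l//.
  by have := Q2; rewrite /h2; lra.
- split; first by apply/tight_eigenvalue; right.
  move=> b /tight_eigenvalue[] -> //=; rewrite ler_pM2l//.
  by have := Q2; rewrite /h2; lra.
Qed.

Let X0 : norm2 tight_sol ^+ 2 = 1 + Q.
Proof. by rewrite norm2_sqr inner_vec2 -expr2 r2 mulr1 addrC. Qed.

Let solSsol : inner tight_sol (S *m tight_sol) = tau ^+ 2.
Proof.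
rewrite tight_second_moment vec2_0 vec2_1 -expr2 r2 /tau /h2; ring.
Qed.

Definition tight_gain : R := (1 + Q) * tau * (1 - dl) ^+ 2 * (1 - Q^-1) ^+ 2.

Lemma tight_slope_gt0 : 0 < max_slope (lossfun I).
Proof.
rewrite lt_def (setting_slope_ge0 tight_setting) andbT; apply/negP => /eqP M0.
have := setting_slope_lip tight_setting 0 tau.
have h0 : - tight_range <= 0 <= tight_range.
  by rewrite oppr_le0 ltW//= ltW.
have ht : - tight_range <= - tau <= tight_range.
  rewrite lerN2 tight_range_ge/=; apply: (@le_trans _ _ 0); last exact: ltW.
  by rewrite oppr_le0 ltW.
rewrite M0 mul0r /= subrr sub0r !huber_id// sqrrN expr0n subr0.
by rewrite normr_le0 sqrf_eq0 gt_eqF.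
Qed.

Lemma tight_subopt_ge : (tight_gain%:E <= subopt I)%E.
Proof.
pose M := max_slope (lossfun I); have M0 : 0 < M := tight_slope_gt0.
have q0 : 0 < Q by have := Q1; lra.
have d1 : 0 < 1 - dl by have /andP[_] := dl01; rewrite subr_gt0.
pose a := tau * (Q - 1 + dl).
have a0 : 0 < a by rewrite mulr_gt0//; have := Q1; have := dl0; lra.
(* Then [S + eta] has eigenvalues [tau] and [tau Q^2], and [a + eta = tau Q] is their geometric
   mean, the equality case of the chord gap. *)
pose eta := tau * (1 - dl).
have eta0 : 0 < eta by rewrite mulr_gt0.
(* This is [2 a eta / (a + eta)], the penalty at which [shrinkage_choice] is an equality. *)
pose gam := 2 * tau * (Q - 1 + dl) * (1 - dl) / Q.
have gam0 : 0 < gam.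
  by rewrite divr_gt0// !mulr_gt0//; have := Q1; have := dl0; lra.
have r0 : 0 < norm2 tight_sol.
  by rewrite lt_def norm2_ge0 andbT -sqrf_eq0 X0 gt_eqF//; have := Q1; lra.
pose rho := gam * norm2 tight_sol / M.
have rho0 : 0 <= rho by rewrite ltW// divr_gt0// mulr_gt0.
have MrhoE w : M * w * rho = gam * norm2 tight_sol * w.
  by rewrite /rho; field; rewrite gt_eqF.
have hhat : (((1 + Q) * (gam - gam ^+ 2 / (4 * a)))%:E <= fhat I rho)%E.
  apply: le_ereal_inf_tmp => _ [t /= + <-]; rewrite in_itv/= => /andP[t0 t1].
  rewrite (frhoE tight_setting)// lee_fin MrhoE /shrink_path/= scaler0 addr0.
  have ns : norm2 ((1 - t) *: tight_sol) = (1 - t) * norm2 tight_sol.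
    by rewrite norm2Z ger0_norm// subr_ge0.
  rewrite tight_emp_loss ns; last first.
    by rewrite ler_piMl ?norm2_ge0//; lra.
  have -> : (1 - t) *: tight_sol - tight_sol = (- t) *: tight_sol.
    by rewrite scalerBl scale1r scaleNr addrAC subrr add0r.
  rewrite -scalemxAr !inner_linE solSsol.
  rewrite (_ : _ * ((1 - t) * _) = gam * (1 - t) * (1 + Q)); last first.
    by rewrite -X0; ring.
  have tE : tau ^+ 2 = a * (1 + Q) by rewrite /a /tau; ring.
  rewrite tE -subr_ge0 (_ : _ - _ = (1 + Q) * (a * (t - gam / (2 * a)) ^+ 2)).
    apply: mulr_ge0; first by have := Q1; lra.
    by apply: mulr_ge0; [exact: ltW|exact: sqr_ge0].
  by field; rewrite gt_eqF.
(* The ridge solution [S (S + eta)^-1 tight_sol]. *)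
pose x := vec2 (dl * r) (h2 / Q ^+ 2).
have xb : norm2 x <= norm2 tight_sol.
  rewrite -ler_sqr ?nnegrE ?norm2_ge0// X0 norm2_sqr inner_vec2.
  have h2Q : h2 / Q ^+ 2 <= 1.
    by rewrite ler_pdivrMr ?exprn_gt0// mul1r /h2; have /andP[_] := dl01; lra.
  have h2Q0 : 0 <= h2 / Q ^+ 2 by rewrite ltW// divr_gt0// exprn_gt0.
  rewrite addrC lerD// -expr2; first by rewrite expr_le1.
  have dl1 : dl <= 1 by have /andP[_] := dl01; lra.
  by rewrite exprMn r2 ler_piMl ?(ltW q0)// exprn_ile1// ltW.
have hstar : (fstar I rho <= (emp_loss (I := I) x + gam * norm2 tight_sol * norm2 x)%:E)%E.
  apply: ge_ereal_inf; exists (frho (I := I) rho x); first by exists x.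
  by rewrite (frhoE tight_setting)// lee_fin MrhoE.
have xE : emp_loss (I := I) x + eta * norm2 x ^+ 2 =
    tau * (1 - dl) * (dl * Q + h2 / Q ^+ 2).
  rewrite tight_emp_loss// (_ : x - tight_sol =
    vec2 ((dl - 1) * r) (h2 / Q ^+ 2 - 1)); last first.
    by apply/colP => i; rewrite !mxE; case: ifP => _; ring.
  rewrite tight_second_moment !vec2_0 !vec2_1 norm2_sqr inner_vec2 /eta /h2.
  have rr : r * r = Q by rewrite -expr2.
  rewrite !(mulrACA _ r) rr; field; rewrite gt_eqF//.
(* The only inexact estimate on [x]; its slack vanishes at [Q = 1, dl = 1/3] and at [Q] golden,
   [dl = 0]. *)
have amgm : gam * norm2 tight_sol * norm2 x <=
    eta * norm2 x ^+ 2 + gam ^+ 2 * (1 + Q) / (4 * eta).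
  rewrite -X0 -subr_ge0.
  rewrite (_ : _ - _ = eta * (norm2 x - gam * norm2 tight_sol / (2 * eta)) ^+ 2).
    by apply: mulr_ge0; [exact: ltW|exact: sqr_ge0].
  by field; rewrite gt_eqF.
apply: le_ereal_sup_tmp; exists (fhat I rho - fstar I rho)%E.
  by exists rho.
apply: le_trans (leeB hhat hstar); rewrite -EFinB lee_fin.
have gE : tight_gain = (1 + Q) * (gam - gam ^+ 2 / (4 * a)) -
    gam ^+ 2 * (1 + Q) / (4 * eta) - tau * (1 - dl) * (dl * Q + h2 / Q ^+ 2).
  rewrite /tight_gain /gam /a /eta /h2 /tau; field.
  by rewrite !gt_eqF//; have := Q1; have := dl0; lra.
rewrite gE; lra.
Qed.

Lemma tight_boundE : bound I = (1 + Q) * tau * (Q ^+ 2 - 1) ^+ 2 /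
  (golden R ^+ 5 * (Q ^+ 2 - 1) + 27 * dl).
Proof.
have g0 : 0 <= golden R ^+ 5 by rewrite exprn_ge0// golden_ge0.
have D0 : 0 < golden R ^+ 5 * (Q ^+ 2 - 1) + 27 * dl.
  by rewrite ltr_wpDl ?mulr_ge0 ?mulr_gt0// subr_ge0 ltW.
rewrite (boundE tight_setting)/= X0 -mulrBr (_ : h2 - dl = Q ^+ 2 - 1); last first.
  by rewrite /h2; ring.
move: D0 tau0; rewrite -/tau; move: (tau) => t D0 t0.
rewrite (_ : _ + 27 * (t * dl) = t * (golden R ^+ 5 * (Q ^+ 2 - 1) + 27 * dl)).
  by move: D0; set D := _ + 27 * dl => D0; field; rewrite !gt_eqF.
by ring.
Qed.

(** The quotient of the two sides of [golden_kernel] at [r = Q], [u = dl]. *)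
Definition tight_ratio : R :=
  (1 - dl) ^+ 2 * (golden R ^+ 5 * (Q ^+ 2 - 1) + 27 * dl) / (Q * (Q + 1)) ^+ 2.

Lemma tight_cond : cond I = 1 + (Q ^+ 2 - 1) / dl.
Proof. by rewrite /cond/= /h2; field; rewrite !gt_eqF. Qed.

Lemma tight_cond_gt1 : 1 < cond I.
Proof. by rewrite tight_cond ltrDl divr_gt0// subr_gt0. Qed.

Lemma tight_sol_neq0 : nominal_sol I != 0.
Proof. by rewrite -norm2_eq0 -sqrf_eq0 X0 gt_eqF//; have := Q1; lra. Qed.

Lemma tight_ratio_le :
  (tight_ratio%:E <= subopt I * ((bound I)^-1)%:E <= 1%:E)%E.
Proof.
have g0 : 0 <= golden R ^+ 5 by rewrite exprn_ge0// golden_ge0.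
have D0 : 0 < golden R ^+ 5 * (Q ^+ 2 - 1) + 27 * dl.
  by rewrite ltr_wpDl ?mulr_ge0 ?mulr_gt0// subr_ge0 ltW.
have q0 : 0 < Q by have := Q1; lra.
have b0 : 0 < bound I.
  rewrite tight_boundE; apply: divr_gt0 => //; apply: mulr_gt0.
    by apply: mulr_gt0 => //; lra.
  by rewrite exprn_gt0// subr_gt0.
have bV0 : (0 <= ((bound I)^-1)%:E)%E by rewrite lee_fin invr_ge0 ltW.
apply/andP; split.
  apply: le_trans (lee_wpmul2r bV0 tight_subopt_ge).
  rewrite -EFinM lee_fin tight_boundE /tight_gain /tight_ratio.
  rewrite le_eqVlt; apply/orP; left; apply/eqP; field.
  have := Q2; rewrite -subr_gt0 => QQ.
  by rewrite !gt_eqF//; lra.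
apply: le_trans (lee_wpmul2r bV0 (subopt_le_bound tight_setting)) _.
by rewrite -EFinM divff// gt_eqF.
Qed.

End TightInstance.

(** * The two asymptotic regimes *)

Lemma golden_gt1 (R : realType) : 1 < golden R.
Proof.
have g2 := goldenE R; rewrite ltNge; apply/negP => g1.
have : golden R ^+ 2 <= golden R by rewrite expr2 ler_piMl ?golden_ge0.
by rewrite g2 gerDl ler10.
Qed.

(** The normalised suboptimality is squeezed between [tight_ratio], continuous in its parameters,
    and 1. *)
Lemma tight_ratio_cvg (R : realType) (Q dl : nat -> R) (q d : R) :
  (forall k, 1 < Q k) -> (forall k, 0 < dl k < 1) ->
  Q @ \oo --> q -> dl @ \oo --> d -> 1 <= q -> tight_ratio q d = 1 ->
  (subopt (tight_instance (Q k) (dl k)) *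
    ((bound (tight_instance (Q k) (dl k)))^-1)%:E)%E @[k --> \oo] --> 1%:E.
Proof.
move=> Q1 dl01 cQ cd q1 r1.
have cr : tight_ratio (Q k) (dl k) @[k --> \oo] --> (1 : R).
  rewrite -r1 /tight_ratio.
  have cQ2 : Q k ^+ 2 @[k --> \oo] --> q ^+ 2 by rewrite expr2; exact: cvgM.
  apply: cvgM.
    apply: cvgM.
      have c1 : (1 - dl k) @[k --> \oo] --> 1 - d by apply: cvgB => //; exact: cvg_cst.
      by rewrite expr2; exact: cvgM.
    apply: cvgD; apply: cvgM => //; try exact: cvg_cst.
    by apply: cvgB => //; exact: cvg_cst.
  apply: cvgV; first by rewrite gt_eqF// exprn_gt0// mulr_gt0//; lra.
  have c1 : (Q k * (Q k + 1)) @[k --> \oo] --> q * (q + 1).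
    by apply: cvgM => //; apply: cvgD => //; exact: cvg_cst.
  by rewrite expr2; exact: cvgM.
apply: (@squeeze_cvge _ _ _ _ (fun k => (tight_ratio (Q k) (dl k))%:E) _ (cst 1%:E)).
- by apply: nearW => k; exact: tight_ratio_le.
- by apply: cvg_EFin => //; exact: nearW.
- exact: cvg_cst.
Qed.

Theorem theorem2 (R : realType) :
  (forall I : instance R,
     quadratic_setting I -> (subopt I <= (bound I)%:E)%E) /\
  (exists I : nat -> instance R,
     (forall k, [/\ quadratic_setting (I k), nominal_sol (I k) != 0 & 1 < cond (I k)]) /\
     (cond (I k) @[k --> \oo] --> (1 : R)) /\
     ((subopt (I k) * ((bound (I k))^-1)%:E)%E @[k --> \oo] --> 1%:E)) /\
  (exists I : nat -> instance R,
     (forall k, [/\ quadratic_setting (I k), nominal_sol (I k) != 0 & 1 < cond (I k)]) /\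
     (cond (I k) @[k --> \oo] --> +oo) /\
     ((subopt (I k) * ((bound (I k))^-1)%:E)%E @[k --> \oo] --> 1%:E)).
Proof.
have h_gt0 k : 0 < (harmonic k : R) by rewrite invr_gt0.
have h_le1 k : (harmonic k : R) <= 1 by rewrite invf_le1// ler1n.
split; first by move=> I; exact: subopt_le_bound.
have inst (Q dl : R) : 1 < Q -> 0 < dl < 1 ->
    [/\ quadratic_setting (tight_instance Q dl),
        nominal_sol (tight_instance Q dl) != 0 & 1 < cond (tight_instance Q dl)].
  by move=> Q1 dl01; split; [exact: tight_setting|exact: tight_sol_neq0|exact: tight_cond_gt1].
split.
  (* [Q] tends to 1 with [dl = 1/3] fixed: the first equality case of [golden_kernel]. *)
  pose Q k : R := 1 + harmonic k.
  have Q1 k : 1 < Q k by rewrite ltrDl.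
  have dl01 : 0 < (3^-1 : R) < 1 by apply/andP; split; lra.
  have cQ : Q @ \oo --> (1 : R).
    rewrite -[X in _ --> X]addr0; apply: cvgD; [exact: cvg_cst|exact: cvg_harmonic].
  exists (fun k => tight_instance (Q k) 3^-1); split; [|split].
  - by move=> k; exact: inst.
  - under eq_fun do rewrite tight_cond//.
    have c2 : Q k ^+ 2 @[k --> \oo] --> (1 : R) ^+ 2 by rewrite !expr2; exact: cvgM.
    have c3 : (Q k ^+ 2 - 1) @[k --> \oo] --> (1 : R) ^+ 2 - 1.
      by apply: cvgB => //; exact: cvg_cst.
    have c4 : ((Q k ^+ 2 - 1) / 3^-1) @[k --> \oo] --> ((1 : R) ^+ 2 - 1) / 3^-1.
      by apply: cvgM => //; exact: cvg_cst.
    have limE : 1 + (1 ^+ 2 - 1) / 3^-1 = 1 :> R by rewrite expr1n subrr mul0r addr0.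
    have c5 : (1 + (Q k ^+ 2 - 1) / 3^-1) @[k --> \oo] --> (1 : R) + (1 ^+ 2 - 1) / 3^-1.
      by apply: cvgD => //; exact: cvg_cst.
    by rewrite limE in c5; exact: c5.
  - apply: (@tight_ratio_cvg _ _ _ 1 3^-1) => //; first exact: cvg_cst.
    by rewrite /tight_ratio expr1n subrr mulr0 add0r; field.
(* [Q] is golden and [dl] tends to 0: the second equality case, with condition number
   [1 + golden R / dl k]. Halving keeps [dl 0] below 1. *)
pose dl k : R := harmonic k / 2.
have dl01 k : 0 < dl k < 1.
  by have := h_gt0 k; have := h_le1 k; rewrite /dl => ? ?; apply/andP; split; lra.
have g1 := golden_gt1 R; have g2 := goldenE R.
exists (fun k => tight_instance (golden R) (dl k)); split; [|split].
- by move=> k; exact: inst.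
- under eq_fun do rewrite tight_cond//.
  apply/cvgryPge => A; near=> k.
  have Ak : A <= k%:R by near: k; exact: nbhs_infty_ger.
  rewrite g2 addrK /dl /harmonic/= invfM invrK.
  have k0 : 0 <= k%:R :> R by [].
  rewrite -natr1; nra.
- apply: (@tight_ratio_cvg _ _ _ (golden R) 0) => //.
  + exact: cvg_cst.
  + by rewrite -[X in _ --> X](mul0r 2^-1); apply: cvgM; [exact: cvg_harmonic|exact: cvg_cst].
  + exact: ltW.
  + rewrite /tight_ratio g2 addrK subr0 expr1n mul1r mulr0 addr0.
    have -> : golden R * (golden R + 1) = golden R ^+ 3 by rewrite -g2 -exprS.
    rewrite -exprSr -exprM divff// expf_neq0// gt_eqF//; lra.
Unshelve. all: by end_near.
Qed.
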